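(* Let $A:\mathcal{D}(A)\to H_1$ be the linear operator $$A=\begin{pmatrix}0&I&0\\-c^2\mathcal{A}&-b\mathcal{A}&I\\0&0&-a\mathcal{A}\end{pmatrix},\qquad \mathcal{D}(A)=\mathcal{D}(\mathcal{A})\times\mathcal{D}(\mathcal{A})\times\mathcal{D}(\mathcal{A}),$$ on $H_1=\mathcal{D}(\mathcal{A}^{1/2})\times\mathcal{H}\times\mathcal{H}$. Then $A$ generates an analytic semigroup $T(t)$ on $H_1$.
   Context: $\mathcal{H}$ is a (separable) Hilbert space with inner product $\langle\cdot,\cdot\rangle_{\mathcal{H}}$ and norm $\|\cdot\|_{\mathcal{H}}$ (in applications $\mathcal{H}=L^2(\Omega)$, $\Omega\subset\mathbb{R}^d$, $d\in\{1,2,3\}$, open and bounded with smooth boundary). $\mathcal{A}:\mathcal{D}(\mathcal{A})\to\mathcal{H}$ is a self-adjoint, strictly positive, closed operator with domain $\mathcal{D}(\mathcal{A})$ dense in $\mathcal{H}$ (in applications $\mathcal{A}=-\Delta$ with domain $H^2(\Omega)\cap H_0^1(\Omega)$), and $\underline{\mu}:=\min\sigma(\mathcal{A})>0$. It is assumed that $\|v\|_{\mathcal{H}}\le C_\nu\|\mathcal{A}^\nu v\|_{\mathcal{H}}$ for $v\in\mathcal{D}(\mathcal{A}^\nu)$, $\nu=\tfrac12,1,\tfrac32$. The constants $a,b,c$ are positive. The space $H_1$ carries the inner product $\langle x,y\rangle_{H_1}=\langle\mathcal{A}^{1/2}x_1,\mathcal{A}^{1/2}y_1\rangle_{\mathcal{H}}+\langle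 x_2,y_2\rangle_{\mathcal{H}}+\langle x_3,y_3\rangle_{\mathcal{H}}$.
   Formalization: ''A generates T(t)'' is read as: the closure of A in H_1 is the infinitesimal generator of T(t), since A with domain D(𝒜)×D(𝒜)×D(𝒜) is not closed when 𝒜 is unbounded and so cannot itself be a generator. *)

(* Defs.v *)
From HB Require Import structures.
From mathcomp Require Import all_boot all_order all_algebra sesquilinear.
From mathcomp Require Import complex.
From mathcomp Require Import all_classical all_reals all_analysis.
From mathcomp Require Import ring.

Set Implicit Arguments.
Unset Strict Implicit.
Unset Printing Implicit Defensive.

Import Order.TTheory GRing.Theory Num.Theory Num.Def.
Import numFieldNormedType.Exports.

Local Open Scope classical_set_scope.
Local Open Scope complex_scope.
Local Open Scope ring_scope.

Section DotNorm.
Variables (C : numClosedFieldType) (U : lmodType C) (f : {dot U for conjC}).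

Definition dot_norm (x : U) : C := sqrtC (f x x).

Lemma dot_sym x y : f x y = (f y x)^*.
Proof. by rewrite (hermitian_subproof (s := f)) expr0 mul1r. Qed.

Lemma dotDl x y z : f (x + y) z = f x z + f y z.
Proof. exact: (linearDl f z x y). Qed.

Lemma dotZl a x z : f (a *: x) z = a * f x z.
Proof. exact: (linearZl_LR f z a x). Qed.

Lemma dotDr x y z : f z (x + y) = f z x + f z y.
Proof. by rewrite dot_sym dotDl rmorphD/= -!dot_sym. Qed.

Lemma dotZr a x z : f z (a *: x) = a^* * f z x.
Proof. by rewrite dot_sym dotZl rmorphM/= -dot_sym. Qed.

Lemma dot0l x : f 0 x = 0.
Proof. by rewrite -(scale0r 0) dotZl mul0r. Qed.

Lemma dot_gt0 x : x != 0 -> 0 < f x x.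
Proof. exact: neq0_dnorm_gt0. Qed.

Lemma dot_ge0 x : 0 <= f x x.
Proof. by have [->|/dot_gt0/ltW//] := eqVneq x 0; rewrite dot0l. Qed.

Lemma dot_normE x : dot_norm x ^+ 2 = f x x.
Proof. exact: sqrtCK. Qed.

Lemma dot_norm_ge0 x : 0 <= dot_norm x.
Proof. by rewrite sqrtC_ge0 dot_ge0. Qed.

Lemma dot_norm0_eq0 x : dot_norm x = 0 -> x = 0.
Proof.
move=> /eqP; rewrite sqrtC_eq0 => /eqP fx0.
by apply/eqP/negPn/negP => /dot_gt0; rewrite fx0 ltxx.
Qed.

Lemma dot_normZ a x : dot_norm (a *: x) = `|a| * dot_norm x.
Proof.
rewrite /dot_norm dotZl dotZr mulrA -normCK.
by rewrite (rootCMl _ _ (exprn_ge0 _ (normr_ge0 _)))// sqrCK.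
Qed.

Lemma dot_CS x y : `|f x y| <= dot_norm x * dot_norm y.
Proof.
rewrite -(@ler_pXn2r _ 2)// ?nnegrE ?mulr_ge0 ?dot_norm_ge0//.
rewrite exprMn !dot_normE.
have [->|y0] := eqVneq y 0.
  by rewrite dot_sym !dot0l conjC0 normr0 expr0n/= mulr0.
have fy0 := dot_gt0 y0.
have := dot_ge0 (f y y *: x - f x y *: y).
rewrite -scaleN1r !(dotDl, dotDr, dotZl, dotZr) !rmorphN !rmorph1.
rewrite (dot_sym y x) (geC0_conj (dot_ge0 y)) normCK => h.
rewrite -subr_ge0 -(pmulr_rge0 _ fy0).
by apply: le_trans h _; rewrite le_eqVlt; apply/orP; left; apply/eqP; ring.
Qed.

Lemma ler_dot_normD x y : dot_norm (x + y) <= dot_norm x + dot_norm y.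
Proof.
rewrite -(@ler_pXn2r _ 2)// ?nnegrE ?addr_ge0 ?dot_norm_ge0//.
rewrite sqrrD !dot_normE dotDl !dotDr -!addrA lerD2l !addrA lerD2r.
rewrite (dot_sym y x); apply: le_trans (real_ler_norm _) _.
  by rewrite CrealE rmorphD/= conjCK addrC.
apply: le_trans (ler_normD _ _) _.
by rewrite norm_conjC lerD ?dot_CS.
Qed.

End DotNorm.

(* An unbounded operator: values of [op_fun] outside [dom] are junk, and are
   never used. *)
Record linop (K : nzRingType) (V : lmodType K) := LinOp {
  dom : submodClosed V;
  op_fun :> V -> V;
  linopP : forall (a : K) x y, x \in dom -> y \in dom ->
    op_fun (a *: x + y) = a *: op_fun x + op_fun y }.

Section LinOpTheory.
Variables (K : nzRingType) (V : lmodType K) (A : linop V).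

Lemma linop0 : A 0 = 0.
Proof.
have := linopP (l := A) 1 (rpred0 _) (rpred0 _).
by rewrite !scale1r addr0 => /(congr1 (fun v => v - A 0)); rewrite addrK subrr.
Qed.

Lemma linopZ (a : K) x : x \in dom A -> A (a *: x) = a *: A x.
Proof. by move=> xA; rewrite -[X in A X]addr0 linopP ?rpred0// linop0 addr0. Qed.

Lemma linopD x y : x \in dom A -> y \in dom A -> A (x + y) = A x + A y.
Proof. by move=> xA yA; rewrite -[x in LHS]scale1r linopP// scale1r. Qed.

Definition graph : set (V * V) := [set p | p.1 \in dom A /\ A p.1 = p.2].

Definition dom_type : Type := {x : V | x \in dom A}.

HB.instance Definition _ := SubChoice.on dom_type.
HB.instance Definition _ := [SubChoice_isSubLmodule of dom_type by <:].

End LinOpTheory.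

Section SelfAdjoint.
Variables (C : numClosedFieldType) (H : completeNormedModType C).
Variable ip : {dot H for conjC}.

(* [y] lies in the domain of the adjoint of [A] and is mapped there to [z] *)
Definition adjoint_graph (A : linop H) : set (H * H) :=
  [set p | forall x, x \in dom A -> ip (A x) p.1 = ip x p.2].

Definition self_adjoint (A : linop H) :=
  dense [set` dom A] /\ adjoint_graph A = graph A.

(* Strictly positive self-adjoint operators; the order of [C] includes being
   real. *)
Record pos_self_adjoint := PosSelfAdjoint {
  psa_op :> linop H;
  psa_self_adjoint : self_adjoint psa_op;
  psa_closed : closed (graph psa_op);
  psa_gt0 : forall x, x \in dom psa_op -> x != 0 -> 0 < ip (psa_op x) x }.

(* The square root $\mathcal A^{1/2}$: the (unique) nonnegative self-adjoint
   operator whose square, with its natural domain, is $\mathcal A$. *)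
Record pos_sqrt (A : pos_self_adjoint) := PosSqrt {
  sqrt_op :> linop H;
  sqrt_self_adjoint : self_adjoint sqrt_op;
  sqrt_ge0 : forall x, x \in dom sqrt_op -> 0 <= ip (sqrt_op x) x;
  sqrt_domE : forall x, (x \in dom A) =
    (x \in dom sqrt_op) && (sqrt_op x \in dom sqrt_op);
  sqrt_sqr : forall x, x \in dom A -> sqrt_op (sqrt_op x) = A x }.

Lemma sqrt_dom_sub (A : pos_self_adjoint) (B : pos_sqrt A) x :
  x \in dom A -> x \in dom B.
Proof. by rewrite (sqrt_domE B) => /andP[]. Qed.

Lemma sqrt_inj0 (A : pos_self_adjoint) (B : pos_sqrt A) x :
  x \in dom B -> B x = 0 -> x = 0.
Proof.
move=> xB Bx0; have xA : x \in dom A by rewrite (sqrt_domE B) xB Bx0 rpred0.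
apply/eqP/negPn/negP => /(psa_gt0 xA).
by rewrite -(sqrt_sqr B xA) Bx0 linop0 dot0l ltxx.
Qed.

Definition resolvent_set (A : linop H) : set C :=
  [set l | exists S : {linear H -> H}, [/\ continuous S,
    forall y, S y \in dom A /\ l *: S y - A (S y) = y &
    forall x, x \in dom A -> S (l *: x - A x) = x]].

Definition spectrum (A : linop H) : set C := ~` resolvent_set A.

End SelfAdjoint.

(* $H_1 = \mathcal D(\mathcal A^{1/2}) \times \mathcal H \times \mathcal H$;
   a fresh name, so that it carries the norm of its inner product rather than
   the sup norm of a product. *)
Definition H1 (C : numClosedFieldType) (H : completeNormedModType C)
    (ip : {dot H for conjC}) (A : pos_self_adjoint ip) (B : pos_sqrt A) : Type :=
  (dom_type B * H * H)%type.

Section H1.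
Variables (C : numClosedFieldType) (H : completeNormedModType C).
Variables (ip : {dot H for conjC}) (A : pos_self_adjoint ip) (B : pos_sqrt A).

HB.instance Definition _ := GRing.Lmodule.copy (H1 B) (dom_type B * H * H)%type.

Definition ipH1 (x y : H1 B) : C :=
  ip (B (val x.1.1)) (B (val y.1.1)) + ip x.1.2 y.1.2 + ip x.2 y.2.

Fact ipH1_bilinear : bilinear_for
  (GRing.Scale.Law.clone _ _ ( *%R ) _) (GRing.Scale.Law.clone _ _ (conjC \; *%R ) _)
  ipH1.
Proof.
split=> [y a [[u1 u2] u3] [[v1 v2] v3]|y a [[u1 u2] u3] [[v1 v2] v3]].
  rewrite /ipH1/= (linopP _ (valP u1) (valP v1)) !(dotDl, dotZl); ring.
rewrite /ipH1/= (linopP _ (valP u1) (valP v1)) !(dotDr, dotZr); ring.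
Qed.

HB.instance Definition _ := bilinear_isBilinear.Build C (H1 B) (H1 B) C
  (GRing.Scale.Law.clone _ _ ( *%R ) _) (GRing.Scale.Law.clone _ _ (conjC \; *%R ) _)
  ipH1 ipH1_bilinear.

Fact ipH1_hermitian x y : ipH1 x y = (-1) ^+ false * conjC (ipH1 y x).
Proof. by rewrite expr0 mul1r /ipH1 !rmorphD/= -!dot_sym. Qed.

HB.instance Definition _ :=
  isHermitianSesquilinear.Build C (H1 B) false conjC ipH1 ipH1_hermitian.

Fact ipH1_gt0 x : x != 0 -> 0 < ipH1 x x.
Proof.
move=> x0; rewrite lt_neqAle /ipH1 !addr_ge0 ?dot_ge0// andbT eq_sym.
apply: contra x0; rewrite !paddr_eq0 ?addr_ge0 ?dot_ge0//.
have ip0 z : ip z z == 0 -> z = 0.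
  by move=> /eqP z0; apply/eqP/negPn/negP => /(dot_gt0 ip); rewrite z0 ltxx.
case: x => [[x1 x2] x3]/= /andP[/andP[/ip0 Bx1 /ip0->] /ip0->].
suff -> : x1 = 0 by [].
by apply/val_inj; rewrite /= (sqrt_inj0 (valP x1) Bx1).
Qed.

HB.instance Definition _ := isDotProduct.Build C (H1 B) ipH1 ipH1_gt0.

Definition ip1 : {dot H1 B for conjC} := ipH1.

HB.instance Definition _ := Lmodule_isNormed.Build C (H1 B)
  (ler_dot_normD ip1) (dot_normZ ip1) (@dot_norm0_eq0 _ _ ip1).


Variables a b c : C.

Definition dom_opA : {pred H1 B} :=
  [pred x : H1 B | [&& val x.1.1 \in dom A, x.1.2 \in dom A & x.2 \in dom A]].

Fact dom_opA_submod : submod_closed dom_opA.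
Proof.
split=> [|k [[x1 x2] x3] [[y1 y2] y3]]; rewrite !inE/= ?rpred0//.
move=> /and3P[x1A x2A x3A] /and3P[y1A y2A y3A].
by rewrite !rpredD ?rpredZ.
Qed.

HB.instance Definition _ :=
  GRing.isSubmodClosed.Build C (H1 B) dom_opA dom_opA_submod.

(* [insubd 0 x2] is [x2] seen in the domain of the square root: it is there as
   soon as [x2 \in dom A]. *)
Definition opA_fun (x : H1 B) : H1 B :=
  let: (x1, x2, x3) := x in
  ((insubd 0 x2, - (c ^+ 2 *: A (val x1)) - b *: A x2 + x3), - (a *: A x3)).

Fact opA_linear k (x y : H1 B) : x \in dom_opA -> y \in dom_opA ->
  opA_fun (k *: x + y) = k *: opA_fun x + opA_fun y.
Proof.
case: x y => [[x1 x2] x3] [[y1 y2] y3] /and3P[/= x1A x2A x3A] /and3P[/= y1A y2A y3A].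
have E z (zA : z \in dom A) : val (insubd (0 : dom_type B) z) = z.
  by rewrite val_insubd (sqrt_dom_sub B zA).
transitivity (opA_fun (k *: x1 + y1, k *: x2 + y2, k *: x3 + y3)); first by [].
rewrite /opA_fun; congr (_, _, _).
- by apply/val_inj; rewrite E ?rpredD ?rpredZ//= !E.
- rewrite /= !linopP// !scalerDr !scalerN !scalerA ![k * _]mulrC.
  rewrite !opprD -!addrA; congr (_ + _); rewrite !addrA; congr (_ + _).
  by rewrite [X in X + _ + _ = _]addrC [X in _ = X + _]addrAC [RHS]addrAC.
- by rewrite /= linopP// scalerDr opprD scalerN !scalerA mulrC.
Qed.

Definition opA : linop (H1 B) := @LinOp C (H1 B) dom_opA opA_fun opA_linear.

End H1.

Section AnalyticSemigroup.
Variables (R : realType) (V : normedModType R[i]).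
Implicit Types T : R[i] -> {linear V -> V}.

Definition sector (delta : R) : set R[i] :=
  [set z | exists r t : R, [/\ 0 < r, `|t| < delta &
    z = (r * cos t) +i* (r * sin t)]].

(* [semigroup_analytic] is complex differentiability in operator norm. *)
Record analytic_semigroup_on (delta : R) T : Prop := AnalyticSemigroupOn {
  semigroup_bounded : forall z, sector delta z -> continuous (T z);
  semigroup0 : forall x, T 0 x = x;
  semigroupD : forall z w x, sector delta z -> sector delta w ->
    T (z + w) x = T z (T w x);
  semigroup_cvg0 : forall x,
    T z x @[z --> within (sector delta) (nbhs (0 : R[i]^o))] --> x;
  semigroup_analytic : forall z, sector delta z ->
    exists2 D : {linear V -> V}, continuous D & forall e : R, 0 < e ->
      \forall h \near nbhs (0 : R[i]^o), forall x,
        `|T (z + h) x - T z x - h *: D x| <= e%:C * `|h| * `|x| }.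

Definition analytic_semigroup T :=
  exists2 delta : R, 0 < delta <= pi / 2 & analytic_semigroup_on delta T.

(* the infinitesimal generator of [T] restricted to the nonnegative reals, as a
   graph *)
Definition generator T : set (V * V) :=
  [set p | (t%:C)^-1 *: (T t%:C p.1 - p.1) @[t --> (0 : R)^'+] --> p.2].

(* The generator of a strongly continuous semigroup is closed, so an operator
   that is only closable is said to generate [T] when its closure is the
   generator of [T], i.e. when its domain is a core. For a closed operator this
   says that it is equal to the generator. *)
Definition generates (A : linop V) T := generator T = closure (graph A).

Definition generates_analytic_semigroup (A : linop V) :=
  exists2 T, analytic_semigroup T & generates A T.

End AnalyticSemigroup.

(* Main.v *)
(* The idea: in an energy norm of $H_1$, that of the coordinates
   $(x_1, x_2 + \varepsilon x_1, x_3)$ with suitable weights, the numerical range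
   of $A$ lies in a sector of the left half-plane, without any shift; and
   $1 - w A$ maps $\mathcal D(A)$ onto a dense subspace for $w$ in a cone around
   the positive axis. So $J_w = (1 - w \bar A)^{-1}$ is a contraction there.

   For such operators $T(z) = \lim_j J_{z/2^j}^{2^j}$, with error estimates on
   $\mathcal D(\bar A^2)$ that telescope from the resolvent identities
   $J_a J_b - J_{a+b} = - a b J_a J_b J_{a+b} \bar A^2$ and
   $J_u - J_w = (u - w) \bar A J_u J_w$. Holomorphy in operator norm rests on
   $\|\bar A T(z)\| \le C / |z|$: by a discrete Cauchy estimate on a circle
   around $w$, contractivity of $J_{w+h}^n$ bounds the coefficient
   $n \bar A J_w^{n+1}$ of $h$. No integral is needed. *)

(* Why the coordinates are mixed: the first row of $A$ carries no damping. In the norm of $H_1$ no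
   negative term of $\mathrm{Re}\langle Ax,x\rangle$ involves $\mathcal A^{1/2}x_1$, so the cross
   term of $x_1$ and $x_2$ in the imaginary part is uncontrolled. Writing $x_2 = w - \varepsilon
   x_1$ in the first row produces the missing $-\varepsilon\|\mathcal A^{1/2}x_1\|^2$, up to the
   weight; $\varepsilon$ is small so that the new error terms can be absorbed.

   Why the closure: in general $A$ is not closed, since in a limit only $c^2x_1 + bx_2$ has to lie
   in $\mathcal D(\mathcal A)$. Correspondingly the range of $1 - wA$ is merely dense: the first row
   gives $x_1 = f_1 + wx_2$, which is in $\mathcal D(\mathcal A)$ only if $f_1$ is.

   Why powers of two: halving the step compares $J_w^2$ with $J_{2w}$, factor by factor. Since the
   energy norm makes each factor a contraction, the errors simply add up. *)
From HB Require Import structures.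
Require Import Defs.
From mathcomp Require Import all_boot all_order all_algebra sesquilinear.
From mathcomp Require Import complex.
From mathcomp Require Import all_classical all_reals all_analysis.
From mathcomp Require Import ring lra.
From mathcomp Require cyclic separable cyclotomic.

Set Implicit Arguments.
Unset Strict Implicit.
Unset Printing Implicit Defensive.

Import Order.TTheory GRing.Theory Num.Theory Num.Def.
Import numFieldNormedType.Exports.
Import Normc.

Local Open Scope classical_set_scope.
Local Open Scope complex_scope.
Local Open Scope ring_scope.

(** * Norms and polynomial functions *)

Section Modulus.
Variable R : realType.
Implicit Types z w : R[i].

Lemma normr_normc z : `|z| = (normc z)%:C.
Proof. by []. Qed.

Lemma normc_ge0 z : 0 <= normc z.
Proof. by case: z => x y; exact: sqrtr_ge0. Qed.

Lemma normc_gt0 z : z != 0 -> 0 < normc z.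
Proof.
move=> z0; rewrite lt_neqAle normc_ge0 andbT eq_sym.
by apply: contra z0 => /eqP/eq0_normc ->.
Qed.

Lemma normc_real (t : R) : 0 <= t -> normc t%:C = t.
Proof. by move=> t0 /=; rewrite expr0n addr0 sqrtr_sqr ger0_norm. Qed.

Lemma normcX z n : normc (z ^+ n) = normc z ^+ n.
Proof.
by elim: n => [|n IH]; rewrite ?expr0 ?normc1// !exprS normcM IH.
Qed.

Lemma normc_Re z : `|complex.Re z| <= normc z.
Proof.
by case: z => x y /=; rewrite -sqrtr_sqr ler_wsqrtr// lerDl sqr_ge0.
Qed.

Lemma normc_Im z : `|complex.Im z| <= normc z.
Proof.
by case: z => x y /=; rewrite -sqrtr_sqr ler_wsqrtr// lerDr sqr_ge0.
Qed.

Lemma natrC n : (n%:R : R[i]) = (n%:R : R)%:C.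
Proof. by rewrite rmorph_nat. Qed.

Lemma normc_nat n : normc (n%:R : R[i]) = n%:R.
Proof. by rewrite natrC normc_real. Qed.

(** In characteristic zero $X^n - 1$ is separable, so it has $n$ distinct roots, and $n$ distinct
    $n$-th roots of unity include a primitive one. *)
Lemma prim_root_exists n : (n > 0)%N -> exists z : R[i], n.-primitive_root z.
Proof.
pose p : {poly R[i]} := 'X^n - 1; have [r Dp] := closed_field_poly_normal p.
move=> n_gt0; rewrite (monicP _) ?monicXnsubC // scale1r in Dp.
have rn1: all n.-unity_root r by apply/allP=> z; rewrite -root_prod_XsubC -Dp.
have sz_r: (n < (size r).+1)%N.
  by rewrite -(size_prod_XsubC r id) -Dp size_XnsubC.
have [|z] := hasP (cyclic.has_prim_root n_gt0 rn1 _ sz_r); last by exists z.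
rewrite -separable.separable_prod_XsubC -Dp cyclotomic.separable_Xn_sub_1 //.
by rewrite pnatr_eq0 -lt0n.
Qed.

Lemma normc_prim_root n z : n.-primitive_root z -> normc z = 1.
Proof.
move=> zn; have n0 := prim_order_gt0 zn.
have : normc z ^+ n == 1 by rewrite -normcX (prim_expr_order zn) normc1.
by rewrite (pexprn_eq1 _ (normc_ge0 z)) gtn_eqF//= => /eqP.
Qed.

End Modulus.

(* [sector] of half-aperture [atan k], with its vertex *)
Definition cone (R : realType) (k : R) (z : R[i]) : bool :=
  `|complex.Im z| <= k * complex.Re z.

Section Cone.
Variables (R : realType) (k : R).
Hypothesis k_gt0 : 0 < k.
Implicit Types z w : R[i].

Lemma cone0 : cone k 0.
Proof. by rewrite /cone/= normr0 mulr0. Qed.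

Lemma cone_real t : 0 <= t -> cone k t%:C.
Proof. by move=> t0; rewrite /cone/= normr0 mulr_ge0// ltW. Qed.

Lemma coneD z w : cone k z -> cone k w -> cone k (z + w).
Proof.
case: z w => [x y] [x' y']; rewrite /cone/= => h h'.
by rewrite mulrDr (le_trans (ler_normD _ _))// lerD.
Qed.

Lemma coneZ t z : 0 <= t -> cone k z -> cone k (t%:C * z).
Proof.
case: z => [x y]; rewrite /cone/= => t0 h.
by rewrite !mul0r subr0 addr0 normrM ger0_norm// mulrCA ler_wpM2l.
Qed.

Lemma cone_div n z : cone k z -> cone k (z / n%:R).
Proof.
by move=> kz; rewrite mulrC natrC -fmorphV; exact: coneZ.
Qed.

Lemma cone_Re_ge0 z : cone k z -> 0 <= complex.Re z.
Proof. by rewrite /cone => /(le_trans (normr_ge0 _)); rewrite pmulr_rge0. Qed.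

End Cone.

Section Norm.
Variables (R : realType) (V : lmodType R[i]) (N : V -> R).

(** The norm is an unbundled real-valued function: [H1] already carries the norm of its inner
    product, and the energy norm has to live on the same type. *)
Record is_norm : Prop := IsNorm {
  normD : forall x y, N (x + y) <= N x + N y;
  normZ : forall a x, N (a *: x) = normc a * N x;
  norm_eq0 : forall x, N x = 0 -> x = 0 }.

Hypothesis NP : is_norm.

Lemma norm0 : N 0 = 0.
Proof. by rewrite -(scale0r 0) (normZ NP) normc0 mul0r. Qed.

Lemma normN x : N (- x) = N x.
Proof. by rewrite -scaleN1r (normZ NP) normcN normc1 mul1r. Qed.

Lemma norm_ge0 x : 0 <= N x.
Proof.
by have := normD NP x (- x); rewrite subrr norm0 normN -mulr2n pmulrn_lge0.
Qed.

Lemma normB x y : N (x - y) <= N x + N y.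
Proof. by rewrite -(normN y) (normD NP). Qed.

Lemma norm_sym x y : N (x - y) = N (y - x).
Proof. by rewrite -normN opprB. Qed.

Lemma norm_trans y x z : N (x - z) <= N (x - y) + N (y - z).
Proof. by rewrite (le_trans _ (normD NP _ _))// addrA subrK. Qed.

Lemma norm_sum n (F : nat -> V) :
  N (\sum_(i < n) F i) <= \sum_(i < n) N (F i).
Proof.
elim: n => [|n IH]; first by rewrite !big_ord0 norm0.
by rewrite !big_ord_recr/= (le_trans (normD NP _ _))// lerD2r.
Qed.

Lemma norm_small x : (forall e, 0 < e -> N x <= e) -> x = 0.
Proof.
move=> h; apply: (norm_eq0 NP); apply/eqP; rewrite eq_le norm_ge0 andbT.
by apply/ler_addgt0Pr => e e0; rewrite add0r h.
Qed.

Definition cvgs (u : nat -> V) (l : V) :=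
  forall e, 0 < e -> exists n0, forall n, (n0 <= n)%N -> N (u n - l) <= e.

Definition cauchys (u : nat -> V) :=
  forall e, 0 < e ->
    exists n0, forall m n, (n0 <= m)%N -> (n0 <= n)%N -> N (u m - u n) <= e.

Lemma cvgs_small (b : R) (u : nat -> V) l :
  (forall n, N (u n - l) <= b / n.+1%:R) -> cvgs u l.
Proof.
move=> h e e0; have b0 : 0 <= b.
  by have := h 0%N; rewrite divr1; apply: le_trans (norm_ge0 _).
exists (Num.truncn (b / e)) => n hn; apply: le_trans (h n) _.
rewrite ler_pdivrMr ?ltr0n// -ler_pdivrMl// mulrC.
apply: ltW; apply: lt_le_trans (truncnS_gt _) _.
by rewrite ler_nat ltnS.
Qed.

Lemma cvgs_unique u l m : cvgs u l -> cvgs u m -> l = m.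
Proof.
move=> ul um; apply/eqP; rewrite -subr_eq0; apply/eqP/norm_small => e e0.
have e2 : 0 < e / 2 by rewrite divr_gt0.
have [[n1 h1] [n2 h2]] := (ul _ e2, um _ e2).
rewrite (le_trans (norm_trans (u (maxn n1 n2)) _ _))// norm_sym (splitr e).
by rewrite lerD ?h1 ?h2 ?leq_maxl ?leq_maxr.
Qed.

Lemma cvgs_ext u v l : u =1 v -> cvgs u l -> cvgs v l.
Proof. by move=> /funext ->. Qed.

Lemma cvgs_cst l : cvgs (fun=> l) l.
Proof. by move=> e e0; exists 0%N => n _; rewrite subrr norm0 ltW. Qed.

Lemma cvgsD u v l m : cvgs u l -> cvgs v m -> cvgs (fun n => u n + v n) (l + m).
Proof.
move=> ul vm e e0; have e2 : 0 < e / 2 by rewrite divr_gt0.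
have [[n1 h1] [n2 h2]] := (ul _ e2, vm _ e2).
exists (maxn n1 n2) => n; rewrite geq_max => /andP[hn1 hn2].
rewrite opprD addrACA (le_trans (normD NP _ _))// (splitr e).
by rewrite lerD ?h1 ?h2.
Qed.

Lemma cvgsZ a u l : cvgs u l -> cvgs (fun n => a *: u n) (a *: l).
Proof.
move=> ul e e0; have [->|a0] := eqVneq a 0.
  by exists 0%N => n _; rewrite !scale0r subrr norm0 ltW.
have [n0 h] := ul (e / normc a) (divr_gt0 e0 (normc_gt0 a0)).
exists n0 => n /h; rewrite -scalerBr (normZ NP).
by rewrite ler_pdivlMr ?normc_gt0// mulrC.
Qed.

Lemma cvgsB u v l m : cvgs u l -> cvgs v m -> cvgs (fun n => u n - v n) (l - m).
Proof.
move=> ul vm; rewrite -scaleN1r.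
apply: (cvgs_ext _ (cvgsD ul (cvgsZ (-1) vm))) => n /=.
by rewrite scaleN1r.
Qed.

Lemma cvgs_norm_le u l (b : R) : cvgs u l -> (forall n, N (u n) <= b) -> N l <= b.
Proof.
move=> ul ub; apply/ler_addgt0Pr => e e0; have [n0 h] := ul e e0.
rewrite -[l](subKr (u n0)) (le_trans (normB _ _))// lerD ?ub//.
exact: h.
Qed.

Lemma cauchys_dense (F : nat -> {linear V -> V}) (D : V -> Prop) x :
  (forall n y, N (F n y) <= N y) ->
  (forall y, D y -> cauchys (fun n => F n y)) ->
  (forall e, 0 < e -> exists2 y, D y & N (x - y) <= e) ->
  cauchys (fun n => F n x).
Proof.
move=> F1 FD Dx e e0; have e3 : 0 < e / 3 by rewrite divr_gt0.
have [y Dy xy] := Dx _ e3; have [n0 h] := FD y Dy _ e3.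
exists n0 => m n hm hn.
have -> : F m x - F n x = F m (x - y) + (F m y - F n y) + F n (y - x).
  by rewrite !linearB/= !addrA !subrK.
have -> : e = e / 3 + e / 3 + e / 3 by field.
rewrite (le_trans (normD NP _ _))// lerD//.
  by rewrite (le_trans (normD NP _ _))// lerD ?h// (le_trans (F1 _ _)).
by rewrite (le_trans (F1 _ _))// norm_sym.
Qed.

Lemma cvgs_contraction (F : {linear V -> V}) u l :
  (forall y, N (F y) <= N y) -> cvgs u l -> cvgs (fun n => F (u n)) (F l).
Proof.
move=> F1 ul e /ul[n0 h]; exists n0 => n /h.
by rewrite -linearB; exact: le_trans.
Qed.

Lemma contraction_iter (F : V -> V) n x :
  (forall y, N (F y) <= N y) -> N (iter n F x) <= N x.
Proof. by move=> F1; elim: n => //= n IH; exact: le_trans IH. Qed.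

(** $P^n - Q^n = \sum_i P^{n-1-i}(P - Q)Q^i$. Only [P] has to be contractive; [Q] has to preserve
    the set [D] on which [P] and [Q] are known to be close. *)
Lemma iter_telescope (P : {linear V -> V}) (Q : V -> V) (D : V -> Prop) (d : R) :
  (forall y, N (P y) <= N y) -> (forall y, D y -> D (Q y)) ->
  (forall y, D y -> N (P y - Q y) <= d) ->
  forall n x, D x -> N (iter n P x - iter n Q x) <= d *+ n.
Proof.
move=> P1 QD PQ n x Dx; elim: n => [|n IH]; first by rewrite subrr norm0.
have DQ : D (iter n Q x) by elim: n {IH} => //= n IH; exact: QD.
rewrite !iterS (le_trans (norm_trans (P (iter n Q x)) _ _))// mulrSr.
by rewrite lerD ?PQ// -linearB (le_trans (P1 _)).
Qed.

End Norm.

(** * A Cauchy estimate for vector-valued polynomials *)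

Section CauchyEstimate.
Variables (R : realType) (V : lmodType R[i]) (N : V -> R).
Hypothesis NP : is_norm N.

(* Polynomial functions with coefficients in [V], together with their first two
   coefficients. *)
Inductive polyfun : (R[i] -> V) -> V -> V -> Prop :=
| PolyZero : polyfun (fun=> 0) 0 0
| PolyCons F a b c : polyfun F a b -> polyfun (fun h => c + h *: F h) c a.

Lemma polyfun_cst c : polyfun (fun=> c) c 0.
Proof.
have -> : (fun=> c) = (fun h : R[i] => c + h *: (0 : V)).
  by apply/funext => h; rewrite scaler0 addr0.
exact: PolyCons PolyZero.
Qed.

Lemma polyfunD F G a b a' b' :
  polyfun F a b -> polyfun G a' b' -> polyfun (fun h => F h + G h) (a + a') (b + b').
Proof.
move=> pF; elim: pF G a' b' => {F a b} [|F a b c pF IH] G a' b' pG.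
  by rewrite !add0r; under eq_fun do rewrite add0r.
case: pG => {G a' b'} [|G a' b' c' pG].
  by rewrite !addr0; under eq_fun do rewrite addr0; exact: PolyCons pF.
have -> : (fun h => c + h *: F h + (c' + h *: G h)) =
    (fun h => c + c' + h *: (F h + G h)).
  by apply/funext => h; rewrite addrACA scalerDr.
exact: PolyCons (IH _ _ _ pG).
Qed.

Lemma polyfun_linear (L : {linear V -> V}) F a b :
  polyfun F a b -> polyfun (fun h => L (F h)) (L a) (L b).
Proof.
elim=> {F a b} [|F a b c pF IH]; first by rewrite linear0; exact: PolyZero.
by under eq_fun do rewrite linearD linearZ; exact: PolyCons IH.
Qed.

Lemma polyfun_coef F a b : polyfun F a b ->
  exists n (f : nat -> V), [/\ f 0%N = a, f 1%N = b &
    forall h, F h = \sum_(i < n.+2) h ^+ i *: f i].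
Proof.
elim=> {F a b} [|F a b c pF [n [f [<- _ Ff]]]].
  by exists 0%N, (fun=> 0); split => // h; rewrite big1// => i _; rewrite scaler0.
exists n.+1, (fun i => if i is j.+1 then f j else c); split => // h.
rewrite big_ord_recl expr0 scale1r; congr (_ + _).
rewrite Ff scaler_sumr; apply: eq_bigr => i _.
by rewrite scalerA -exprS.
Qed.

(* Averaging [F] against a power of a root of unity isolates the coefficient
   of degree one. *)
Lemma cauchy_estimate F a b (r M : R) :
  polyfun F a b -> 0 <= r -> (forall h, normc h <= r -> N (F h) <= M) ->
  r * N b <= M.
Proof.
move=> /polyfun_coef[n [f [_ <- Ff]]] r0 FM; pose m := n.+2.
have [w wP] := @prim_root_exists R m isT.
have w1 := normc_prim_root wP.
(* [m] exceeds the degree and [n.+1] is [m - 1], so the weight is $w^{-j}$: the sum over $j$ keeps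
   only the term of degree one, [m] times. *)
have avg : \sum_(j < m) (w ^+ (n.+1 * j)) *: F (r%:C * w ^+ j) =
    (m%:R * r%:C) *: f 1%N.
  under eq_bigr do rewrite Ff scaler_sumr.
  rewrite exchange_big/= (bigD1 (Ordinal (isT : 1 < n.+2)%N))//=.
  rewrite [X in _ + X]big1 ?addr0 => [|i i1].
    have -> : m%:R = \sum_(j < m) (1 : R[i]) by rewrite sumr_const card_ord.
    rewrite mulr_suml scaler_suml.
    apply: eq_bigr => j _; rewrite scalerA expr1 mulrCA -exprD -mulSnr.
    by rewrite exprM (prim_expr_order wP) expr1n mulr1 mul1r.
  transitivity ((r%:C ^+ i * \sum_(j < m) (w ^+ (n.+1 + i)) ^+ j) *: f i).
    rewrite mulr_sumr scaler_suml; apply: eq_bigr => j _; rewrite scalerA.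
    by rewrite exprMn mulrCA -!exprM -exprD mulnDl [(j * i)%N]mulnC.
  (* Since $0 \le i < m$ and $i \ne 1$, [m] does not divide $i - 1$; the sum of the powers of an
     [m]-th root of unity other than 1 vanishes. *)
  have : w ^+ (n.+1 + i) != 1.
    rewrite -(prim_order_dvd wP); apply: contra i1; rewrite -val_eqE/=.
    have -> : (n.+1 + i = m + i - 1)%N by rewrite /m addSn subn1.
    case: i => [[|[|i]]]//= im.
      by rewrite addn0 subn1/= => /dvdn_leq -/(_ isT); rewrite /m/= ltnn.
    rewrite addnS subn1/= dvdn_addr// => /dvdn_leq -/(_ isT) /(leq_trans im) /ltnW.
    by rewrite ltnn.
  have : (w ^+ (n.+1 + i)) ^+ m = 1.
    by rewrite -exprM mulnC exprM (prim_expr_order wP) expr1n.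
  move: (w ^+ _) => v vm v1.
  
  have : (v - 1) * \sum_(j < m) v ^+ j = 0 by rewrite -subrX1 vm subrr.
  by move/eqP; rewrite mulf_eq0 subr_eq0 (negPf v1) => /eqP ->; rewrite mulr0 scale0r.
have := norm_sum NP m (fun j => (w ^+ (n.+1 * j)) *: F (r%:C * w ^+ j)).
rewrite avg (normZ NP) normcM normc_nat normc_real// => h.
rewrite -(@ler_pM2l _ m%:R) ?ltr0n// mulrA (le_trans h)//.
rewrite mulr_natl -[X in M *+ X]card_ord -sumr_const ler_sum// => j _.
rewrite (normZ NP) normcX w1 expr1n mul1r FM//.
by rewrite normcM normcX w1 expr1n mulr1 normc_real.
Qed.

End CauchyEstimate.

(** * The semigroup of a family of contractive resolvents *)

Section IterLinear.
Variables (K : nzRingType) (V : lmodType K) (n : nat) (F : {linear V -> V}).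

Fact iter_is_linear : linear (iter n F).
Proof. by move=> a x y; elim: n => //= m ->; rewrite linearP. Qed.

HB.instance Definition _ :=
  GRing.isLinear.Build K V V *:%R (iter n F) iter_is_linear.

End IterLinear.

Lemma iter_comp (T : Type) (F G : T -> T) n x :
  (forall y, F (G y) = G (F y)) ->
  iter n F (iter n G x) = iter n (F \o G) x.
Proof.
move=> FG; elim: n => //= n IH; rewrite -IH; congr F.
by elim: n (iter n G x) {IH} => //= n IH y; rewrite IH FG.
Qed.

Section Limits.
Variables (R : realType) (V : lmodType R[i]) (N : V -> R).
Hypothesis NP : is_norm N.

Lemma invr_exp2_le j : (2 ^+ j)^-1 <= (j.+1%:R)^-1 :> R.
Proof.
by rewrite lef_pV2 ?posrE ?exprn_gt0 ?ltr0n// -natrX ler_nat ltn_expl.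
Qed.

Lemma cauchys_geometric (u : nat -> V) (c : R) :
  (forall j i, N (u (j + i)%N - u j) <= c / 2 ^+ j) -> cauchys N u.
Proof.
move=> h; have c0 : 0 <= c.
  by have := h 0%N 0%N; rewrite divr1; apply: le_trans (norm_ge0 NP _).
move=> e e0; exists (Num.truncn (2 * c / e)) => m n hm hn.
set j := Num.truncn _ in hm hn.
have P i : (j <= i)%N -> N (u i - u j) <= e / 2.
  move=> ji; rewrite -(subnKC ji) (le_trans (h _ _))//.
  rewrite (le_trans (ler_wpM2l c0 (invr_exp2_le j)))//.
  rewrite ler_pdivrMr ?ltr0n// -ler_pdivrMl ?divr_gt0// invf_div.
  by rewrite mulrAC; apply/ltW/(lt_le_trans (truncnS_gt _)).
rewrite (le_trans (norm_trans NP (u j) _ _))// (splitr e) lerD ?P//.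
by rewrite (norm_sym NP) P.
Qed.

Lemma cvgs_contractions (F : nat -> {linear V -> V}) u l m :
  (forall n y, N (F n y) <= N y) -> cvgs N u l -> cvgs N (fun n => F n l) m ->
  cvgs N (fun n => F n (u n)) m.
Proof.
move=> F1 ul Fm e e0; have e2 : 0 < e / 2 by rewrite divr_gt0.
have [[n1 h1] [n2 h2]] := (ul _ e2, Fm _ e2).
exists (maxn n1 n2) => n; rewrite geq_max => /andP[hn1 hn2].
rewrite (le_trans (norm_trans NP (F n l) _ _))// (splitr e).
by rewrite lerD ?h2// -linearB (le_trans (F1 _ _))// h1.
Qed.

Lemma contraction_eq (F G : {linear V -> V}) (D : V -> Prop) x :
  (forall y, N (F y) <= N y) -> (forall y, N (G y) <= N y) ->
  (forall y, D y -> F y = G y) ->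
  (forall e, 0 < e -> exists2 y, D y & N (x - y) <= e) -> F x = G x.
Proof.
move=> F1 G1 FG Dx; apply/eqP; rewrite -subr_eq0; apply/eqP/(norm_small NP).
move=> e e0; have [y Dy xy] := Dx _ (divr_gt0 e0 (ltr0Sn R 1)).
rewrite (le_trans (norm_trans NP (F y) _ _))// (splitr e) lerD//.
  by rewrite -linearB (le_trans (F1 _)).
by rewrite FG// -linearB (le_trans (G1 _))// (norm_sym NP).
Qed.

End Limits.

Section Resolvents.
Variables (R : realType) (V : lmodType R[i]) (N : V -> R) (k : R).
Variables (J : R[i] -> {linear V -> V}) (Gr : V -> V -> Prop).

(* [J w] is the resolvent $(1 - w G)^{-1}$ of the operator [G] with graph
   [Gr]. *)
Record resolvent_family : Prop := ResolventFamily {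
  rf_complete : forall u, cauchys N u -> exists l, cvgs N u l;
  rf_cone : 0 < k;
  rf0 : forall x, J 0 x = x;
  rf_le : forall w x, cone k w -> N (J w x) <= N x;
  rf_graph : forall w x, cone k w -> w != 0 ->
    Gr (J w x) (w^-1 *: (J w x - x));
  rf_cancel : forall w x y, cone k w -> Gr x y -> J w (x - w *: y) = x;
  rf_linear : forall a x y x' y', Gr x y -> Gr x' y' ->
    Gr (a *: x + x') (a *: y + y');
  rf_closed : forall x y, (forall e, 0 < e ->
    exists x' y', [/\ Gr x' y', N (x - x') <= e & N (y - y') <= e]) -> Gr x y;
  rf_dense : forall x e, 0 < e -> exists x' y', Gr x' y' /\ N (x - x') <= e }.

Hypothesis NP : is_norm N.
Hypothesis JP : resolvent_family.

Let k_gt0 := rf_cone JP.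

Lemma Gr0 : Gr 0 0.
Proof.
have [x [y [xy _]]] := rf_dense JP 0 ltr01.
by have := rf_linear JP (-1) xy xy; rewrite !scaleN1r !addNr.
Qed.

Lemma GrD x y x' y' : Gr x y -> Gr x' y' -> Gr (x + x') (y + y').
Proof. by move=> h /(rf_linear JP 1 h); rewrite !scale1r. Qed.

Lemma GrZ a x y : Gr x y -> Gr (a *: x) (a *: y).
Proof. by move=> h; have := rf_linear JP a h Gr0; rewrite !addr0. Qed.

Lemma GrB x y x' y' : Gr x y -> Gr x' y' -> Gr (x - x') (y - y').
Proof. by move=> h /(GrZ (-1)) /(GrD h); rewrite !scaleN1r. Qed.

Lemma resolventE w x y : cone k w -> Gr x y -> J w x - x = w *: J w y.
Proof.
move=> kw xy; have := rf_cancel JP kw xy; rewrite linearB linearZ/= => h.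
by rewrite -[X in _ - X]h opprB addrC subrK.
Qed.

Lemma Gr_resolvent w x y : cone k w -> Gr x y -> Gr (J w x) (J w y).
Proof.
move=> kw xy; have [->|w0] := eqVneq w 0; first by rewrite !(rf0 JP).
by have := rf_graph JP x kw w0; rewrite (resolventE kw xy) scalerA mulVf// scale1r.
Qed.

(** [J u] preserves the graph, so it may be applied to the graph pair of [J w x]; cancelling with
    [J w] gives the claim. *)
Lemma resolvent_comm u w x : cone k u -> cone k w -> J u (J w x) = J w (J u x).
Proof.
move=> ku kw; have [->|w0] := eqVneq w 0; first by rewrite !(rf0 JP).
have := rf_cancel JP kw (Gr_resolvent ku (rf_graph JP x kw w0)).
rewrite [J u (_ *: _)]linearZ/= scalerA mulfV// scale1r [J u (_ - _)]linearB/=.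
by rewrite opprB addrC subrK.
Qed.

Lemma resolvent_sub_le w x y : cone k w -> Gr x y ->
  N (J w x - x) <= normc w * N y.
Proof.
move=> kw xy; rewrite (resolventE kw xy) (normZ NP).
by rewrite ler_wpM2l ?normc_ge0// (rf_le JP).
Qed.

Lemma resolvent_cvg0 x e : 0 < e -> exists2 d, 0 < d &
  forall w, cone k w -> normc w <= d -> N (J w x - x) <= e.
Proof.
move=> e0; have e3 : 0 < e / 3 by rewrite divr_gt0.
have [x' [y [xy xx']]] := rf_dense JP x e3.
have Ny : 0 < N y + 1 by rewrite ltr_wpDl// (norm_ge0 NP).
exists (e / 3 / (N y + 1)) => [|w kw wd]; first by rewrite divr_gt0.
have -> : J w x - x = J w (x - x') + (J w x' - x') + (x' - x).
  by rewrite linearB/= !addrA !subrK.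
have -> : e = e / 3 + e / 3 + e / 3 by field.
rewrite (le_trans (normD NP _ _))// lerD//; last by rewrite (norm_sym NP).
rewrite (le_trans (normD NP _ _))// lerD//; first by rewrite (le_trans (rf_le JP _ _)).
rewrite (le_trans (resolvent_sub_le kw xy))//.
rewrite (le_trans (ler_wpM2r (norm_ge0 NP y) wd))//.
by rewrite mulrAC ler_pdivrMr// ler_wpM2l ?lerDl// ltW.
Qed.

(** The domain of $G^2$ is a core of $G$: for small real $t$, [J t] moves [x] and [y] little, and it
    gains one power of the domain. *)
Lemma Gr_core x y e : Gr x y -> 0 < e -> exists x' y' z,
  [/\ Gr x' y', Gr y' z, N (x - x') <= e & N (y - y') <= e].
Proof.
move=> xy e0.
have [[d1 d10 h1] [d2 d20 h2]] := (resolvent_cvg0 x e0, resolvent_cvg0 y e0).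
pose t := Num.min d1 d2; have t0 : 0 < t by rewrite lt_min d10.
have kt : cone k t%:C by apply: cone_real => //; exact: ltW.
have tC0 : t%:C != 0 by rewrite eq_complex/= eqxx andbT gt_eqF.
exists (J t%:C x), (J t%:C y), ((t%:C)^-1 *: (J t%:C y - y)); split.
- exact: Gr_resolvent.
- exact: rf_graph.
- by rewrite (norm_sym NP) h1// normc_real ?ge_min ?lexx// ltW.
- by rewrite (norm_sym NP) h2// normc_real ?ge_min ?lexx ?orbT// ltW.
Qed.

Lemma Gr2_dense x e : 0 < e ->
  exists2 x', (exists y' z, Gr x' y' /\ Gr y' z) & N (x - x') <= e.
Proof.
move=> e0; have e2 : 0 < e / 2 by rewrite divr_gt0.
have [x1 [y1 [xy1 xx1]]] := rf_dense JP x e2.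
have [x2 [y2 [z [xy2 yz x12 _]]]] := Gr_core xy1 e2.
exists x2; first by exists y2, z.
by rewrite (le_trans (norm_trans NP x1 _ _))// (splitr e) lerD.
Qed.

(** If $(0, z)$ is in the graph, then $dJ_dz = J_d0 - 0 = 0$ for all small $d > 0$, while $J_dz \to
    z$. *)
Lemma Gr_fun x y y' : Gr x y -> Gr x y' -> y = y'.
Proof.
move=> xy xy'; apply/eqP; rewrite -subr_eq0; apply/eqP/(norm_small NP) => e e0.
have := GrB xy xy'; rewrite subrr; set z := y - y' => z0.
have [d d0 h] := resolvent_cvg0 z e0.
have kd : cone k d%:C by apply: cone_real => //; exact: ltW.
have dC0 : d%:C != 0 by rewrite eq_complex/= eqxx andbT gt_eqF.
have := resolventE kd z0; rewrite linear0 subrr => /esym/eqP.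
rewrite scaler_eq0 (negPf dC0)/= => /eqP Jz.
by have := h _ kd; rewrite (normc_real (ltW d0)) Jz sub0r (normN NP); exact.
Qed.

Lemma resolvent_diff u w x y : cone k u -> cone k w -> Gr x y ->
  J u x - J w x = (u - w) *: J w (J u y).
Proof.
move=> ku kw xy.
have E1 : J u x = J w (J u (x - w *: y)).
  by rewrite resolvent_comm// (rf_cancel JP kw xy).
have E2 : J w x = J w (J u (x - u *: y)) by rewrite (rf_cancel JP ku xy).
rewrite {}E1 {}E2 -!linearB/=.
have -> : x - w *: y - (x - u *: y) = (u - w) *: y.
  by rewrite opprB addrC addrA subrK scalerBl.
by rewrite !linearZ.
Qed.

(** The bound on $G^2x$ is part of the set, which makes the set invariant under the contractions
    [J w], as [iter_telescope] requires. *)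
Definition dom2 (L : R) (x : V) := exists y z, [/\ Gr x y, Gr y z & N z <= L].

Lemma dom2_resolvent L w x : cone k w -> dom2 L x -> dom2 L (J w x).
Proof.
move=> kw [y [z [xy yz zL]]]; exists (J w y), (J w z); split.
- exact: Gr_resolvent.
- exact: Gr_resolvent.
- exact: le_trans (rf_le JP _ _) zL.
Qed.

Lemma resolvent_mul_le L a b x : cone k a -> cone k b -> dom2 L x ->
  N (J a (J b x) - J (a + b) x) <= normc a * normc b * L.
Proof.
move=> ka kb [y [z [xy yz zL]]]; have kab := coneD ka kb.
have E1 : J a (J b x) = J a (J b (J (a + b) (x - (a + b) *: y))).
  by rewrite (rf_cancel JP kab xy).
(* The argument on the right is $(1 - bG)(1 - aG)x$; it differs from $(1 - (a+b)G)x$ by $abG^2x$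
   only. *)
have E2 : J (a + b) x = J a (J b (J (a + b) (x - a *: y - b *: (y - a *: z)))).
  rewrite (resolvent_comm _ kb kab) (resolvent_comm _ ka kab); congr (J _ _).
  have h : Gr (x - a *: y) (y - a *: z) by apply/GrB/GrZ.
  by rewrite (rf_cancel JP kb h) (rf_cancel JP ka xy).
rewrite {}E1 {}E2 -!linearB/=.
have -> : x - (a + b) *: y - (x - a *: y - b *: (y - a *: z)) = - ((a * b) *: z).
  apply/eqP; rewrite subr_eq [eqbRHS]addrC -addrA -opprD scalerBr scalerA.
  by rewrite [b * a]mulrC subrK scalerDl opprD addrA.
rewrite !linearN (normN NP) !linearZ/= (normZ NP) normcM.
rewrite ler_wpM2l ?mulr_ge0 ?normc_ge0//.
by do !rewrite (le_trans (rf_le JP _ _))//.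
Qed.

(* The implicit Euler approximation of the semigroup with [2 ^ j] steps. *)
Definition euler j z : {linear V -> V} := iter (2 ^ j) (J (z / (2 ^ j)%:R)).

Lemma eulerE j z x : euler j z x = iter (2 ^ j) (J (z / (2 ^ j)%:R)) x.
Proof. by []. Qed.

Lemma iter_resolvent_le n w x : cone k w -> N (iter n (J w) x) <= N x.
Proof. by move=> kw; apply: contraction_iter => y; exact: rf_le. Qed.

Lemma euler_le j z x : cone k z -> N (euler j z x) <= N x.
Proof. by move=> kz; exact/iter_resolvent_le/cone_div. Qed.

Lemma normc_div (z : R[i]) n : normc (z / n%:R) = normc z / n%:R.
Proof. by rewrite normcM normcV normc_nat. Qed.

(** There are $2^j$ replacements of $J_{2w}$ by $J_w^2$, each with error $|w|^2L$, where $w =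
    z/2^{j+1}$. *)
Lemma euler_step L j z x : cone k z -> dom2 L x ->
  N (euler j.+1 z x - euler j z x) <= normc z ^+ 2 * L / 2 / 2 ^+ j.+1.
Proof.
move=> kz Dx; set w := z / (2 ^ j.+1)%:R; have kw : cone k w by exact: cone_div.
have E2 : z / (2 ^ j)%:R = w + w.
  by rewrite /w expnS natrM; field; rewrite !pnatr_eq0 -lt0n expn_gt0.
have -> : euler j.+1 z x = iter (2 ^ j) (J w \o J w) x.
  by rewrite -iter_comp// -iterD addnn -mul2n -expnS.
rewrite /euler E2.
have JJ1 y : N ((J w \o J w) y) <= N y.
  by rewrite /= (le_trans (rf_le JP _ _))// rf_le.
have h := iter_telescope NP JJ1
  (fun y => @dom2_resolvent L (w + w) y (coneD kw kw))
  (fun y => @resolvent_mul_le L w w y kw kw).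
rewrite (le_trans (h _ _ Dx))// -[leLHS]mulr_natr normc_div !natrX le_eqVlt.
by apply/orP; left; apply/eqP; rewrite !(exprSr 2); field; rewrite ?expf_neq0 ?pnatr_eq0.
Qed.

Lemma euler_cauchy_rate L z x j i : cone k z -> dom2 L x ->
  N (euler (j + i) z x - euler j z x) <= normc z ^+ 2 * L / 2 / 2 ^+ j.
Proof.
move=> kz Dx; have L0 : 0 <= normc z ^+ 2 * L / 2.
  case: Dx => [y [u [_ _ uL]]].
  by rewrite !mulr_ge0 ?exprn_ge0 ?normc_ge0 ?invr_ge0// (le_trans (norm_ge0 NP u)).
set c := normc z ^+ 2 * L / 2 in L0 *.
(* The errors of [euler_step] sum to this difference exactly, which makes the induction on [i] go
   through. *)
suff h : N (euler (j + i) z x - euler j z x) <= c / 2 ^+ j - c / 2 ^+ (j + i).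
  by rewrite (le_trans h)// gerBl divr_ge0 ?exprn_ge0.
elim: i => [|i IH]; first by rewrite addn0 !subrr (norm0 NP).
rewrite addnS (le_trans (norm_trans NP (euler (j + i) z x) _ _))//.
have := lerD (euler_step (j + i) kz Dx) IH; rewrite -/c.
move/le_trans; apply; rewrite le_eqVlt; apply/orP; left; apply/eqP.
by rewrite (exprSr 2); field; rewrite !expf_neq0 ?pnatr_eq0.
Qed.

Lemma euler_cauchy z x : cone k z -> cauchys N (fun j => euler j z x).
Proof.
move=> kz; apply: (cauchys_dense NP (D := fun y => exists L, dom2 L y)).
- by move=> n y; exact: euler_le.
- move=> y [L yL]; apply: (cauchys_geometric NP) => j i.
  exact: euler_cauchy_rate yL.
- move=> e e0; have [x' [y [u [xy yu]]] xx'] := Gr2_dense x e0.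
  by exists x' => //; exists (N u), y, u.
Qed.

(** Off the cone, the identity is a placeholder that keeps the map linear for every [z]. *)
Definition semigroup_fun z x : V :=
  if cone k z then xget 0 [set l | cvgs N (fun j => euler j z x) l]%classic else x.

Lemma semigroup_cvg z x : cone k z ->
  cvgs N (fun j => euler j z x) (semigroup_fun z x).
Proof.
move=> kz; rewrite /semigroup_fun kz.
have [l xl] := rf_complete JP (euler_cauchy x kz).
exact: (@xgetPex _ 0 [set l | cvgs N (fun j => euler j z x) l]%classic (ex_intro _ l xl)).
Qed.

Fact semigroup_linear z : linear (semigroup_fun z).
Proof.
move=> a x y; have [kz|kz] := boolP (cone k z); last first.
  by rewrite /semigroup_fun (negPf kz).
apply: (cvgs_unique NP (semigroup_cvg _ kz)).
have := cvgsD NP (cvgsZ NP a (semigroup_cvg x kz)) (semigroup_cvg y kz).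
by apply: cvgs_ext => j; rewrite linearP.
Qed.

HB.instance Definition _ z :=
  GRing.isLinear.Build R[i] V V *:%R (semigroup_fun z) (semigroup_linear z).

Definition semigroup z : {linear V -> V} := semigroup_fun z.

Local Notation T := semigroup.

Lemma semigroup_le z x : cone k z -> N (T z x) <= N x.
Proof.
move=> kz; apply: (cvgs_norm_le NP (semigroup_cvg x kz)) => j.
exact: euler_le.
Qed.

Lemma semigroup_at0 x : T 0 x = x.
Proof.
have h := semigroup_cvg x (@cone0 R k).
apply: (cvgs_unique NP h); apply: cvgs_ext (cvgs_cst NP x) => j.
rewrite /euler mul0r; elim: (2 ^ j)%N => //= n <-.
by rewrite (rf0 JP).
Qed.

Lemma Gr_iter n w x y : cone k w -> Gr x y ->
  Gr (iter n (J w) x) (iter n (J w) y).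
Proof. by move=> kw xy; elim: n => //= n IH; exact: Gr_resolvent. Qed.

Lemma Gr_cvgs x y u v : cvgs N u x -> cvgs N v y -> (forall n : nat, Gr (u n) (v n)) ->
  Gr x y.
Proof.
move=> ux vy uv; apply: (rf_closed JP) => e e0.
have [[n1 h1] [n2 h2]] := (ux _ e0, vy _ e0).
exists (u (maxn n1 n2)), (v (maxn n1 n2)).
by split; rewrite // (norm_sym NP) ?h1 ?h2 ?leq_maxl ?leq_maxr.
Qed.

Lemma Gr_semigroup z x y : cone k z -> Gr x y -> Gr (T z x) (T z y).
Proof.
move=> kz xy; apply: (Gr_cvgs (semigroup_cvg x kz) (semigroup_cvg y kz)) => j.
exact/Gr_iter/xy/cone_div.
Qed.

Lemma euler_mul_le L j z w x : cone k z -> cone k w -> dom2 L x ->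
  N (euler j z (euler j w x) - euler j (z + w) x) <=
    normc z * normc w * L / 2 ^+ j.
Proof.
move=> kz kw Dx; set n := (2 ^ j)%:R : R[i].
have ka : cone k (z / n) by exact: cone_div.
have kb : cone k (w / n) by exact: cone_div.
rewrite !eulerE -/n iter_comp => [|y]; last exact: resolvent_comm.
have JJ1 y : N ((J (z / n) \o J (w / n)) y) <= N y.
  by rewrite /= (le_trans (rf_le JP _ _))// rf_le.
have h := iter_telescope NP JJ1
  (fun y => @dom2_resolvent L (z / n + w / n) y (coneD ka kb))
  (fun y => @resolvent_mul_le L (z / n) (w / n) y ka kb).
rewrite mulrDl (le_trans (h _ _ Dx))// -[leLHS]mulr_natr !normc_div !natrX le_eqVlt.
by apply/orP; left; apply/eqP; field; rewrite expf_neq0 ?pnatr_eq0.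
Qed.

Lemma semigroup_add z w x : cone k z -> cone k w -> T (z + w) x = T z (T w x).
Proof.
move=> kz kw; have kzw := coneD kz kw.
apply/esym; apply: (contraction_eq NP (F := T z \o T w)
  (D := fun y => exists L, dom2 L y)).
- by move=> y; rewrite /= (le_trans (semigroup_le _ _))// semigroup_le.
- by move=> y; exact: semigroup_le.
- move=> y [L Dy] /=.
  have h1 : cvgs N (fun j => euler j z (euler j w y)) (T z (T w y)).
    apply: (cvgs_contractions NP _ (semigroup_cvg y kw) (semigroup_cvg _ kz)).
    by move=> n v; exact: euler_le.
  have h2 := cvgsB NP h1 (semigroup_cvg y kzw).
  apply/eqP; rewrite -subr_eq0; apply/eqP; apply: (cvgs_unique NP h2).
  apply: (cvgs_small NP (b := normc z * normc w * L)) => n; rewrite subr0.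
  rewrite (le_trans (euler_mul_le _ kz kw Dy))// ler_wpM2l ?invr_exp2_le//.
  case: Dy => [y' [u [_ _ uL]]].
  by rewrite !mulr_ge0 ?normc_ge0// (le_trans (norm_ge0 NP u)).
- move=> e e0; have [x' [y [u [xy yu]]] xx'] := Gr2_dense x e0.
  by exists x' => //; exists (N u), y, u.
Qed.

Lemma iter_sub_le n w x y : cone k w -> Gr x y ->
  N (iter n (J w) x - x) <= n%:R * normc w * N y.
Proof.
move=> kw xy; pose D v := exists2 v', Gr v v' & N v' <= N y.
have Dx : D x by exists y.
have h := iter_telescope NP (fun v => rf_le JP v kw) (Q := id) (D := D)
  (d := normc w * N y) _ _ n Dx.
have {h} := h (fun v => id); rewrite (iter_fix n (erefl : id x = x)) => h.
rewrite -mulrA mulr_natl h// => v [v' vv' v'y].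
by rewrite (le_trans (resolvent_sub_le kw vv'))// ler_wpM2l ?normc_ge0.
Qed.

Lemma semigroup_sub_le z x y : cone k z -> Gr x y ->
  N (T z x - x) <= normc z * N y.
Proof.
move=> kz xy; apply: (cvgs_norm_le NP (u := fun j => euler j z x - x)).
  exact: (cvgsB NP (semigroup_cvg x kz) (cvgs_cst NP x)).
move=> j; rewrite (le_trans (iter_sub_le _ (cone_div _ kz) xy))//.
by rewrite normc_div mulrCA mulfV ?mulr1// pnatr_eq0 -lt0n expn_gt0.
Qed.

Lemma iter_diff_le n u w x y : cone k u -> cone k w -> Gr x y ->
  N (iter n (J u) x - iter n (J w) x) <= n%:R * normc (u - w) * N y.
Proof.
move=> ku kw xy; pose D v := exists2 v', Gr v v' & N v' <= N y.
have Dx : D x by exists y.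
rewrite -mulrA mulr_natl.
apply: (iter_telescope NP (fun v => rf_le JP v ku) (D := D)) => //.
  move=> v [v' vv' v'y]; exists (J w v'); first exact: Gr_resolvent.
  by rewrite (le_trans (rf_le JP _ _)).
move=> v [v' vv' v'y]; rewrite (resolvent_diff ku kw vv') (normZ NP).
rewrite ler_wpM2l ?normc_ge0//.
by do 2!rewrite (le_trans (rf_le JP _ _))//.
Qed.

(** A first-order Taylor formula for $w \mapsto J_w^n$, whose derivative is $nGJ_w^{n+1}$. The
    remainder scales like $(n|u-w|)^2$, so it survives the passage to $u/n$, $w/n$ as $n \to
    \infty$. *)
Lemma iter_taylor n u w x y z : cone k u -> cone k w -> Gr x y -> Gr y z ->
  N (iter n (J u) x - iter n (J w) x - (n%:R * (u - w)) *: iter n.+1 (J w) y) <=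
    (n%:R * normc (u - w)) ^+ 2 * N z.
Proof.
move=> ku kw xy yz; set D := u - w; elim: n => [|n IH].
  by rewrite !mul0r expr0n/= mul0r scale0r !subr0 subrr (norm0 NP).
set a := iter n.+1 (J u) x - _ - _.
(* By [resolvent_diff] the last factor $J_u$ is replaced by $J_w$ at the cost of $(u-w)J_wJ_uG$. The
   old error and the new one contribute $n^2$ and $n + 1$, together at most $(n+1)^2$. *)
have -> : a = J w (iter n (J u) x - iter n (J w) x -
      (n%:R * D) *: iter n.+1 (J w) y) +
    D *: J w (iter n.+1 (J u) y - iter n.+1 (J w) y).
  rewrite /a !(raddfB (J w))/= [J w (_ *: _)]linearZ/= -[in LHS]natr1.
  rewrite mulrDl mul1r scalerDl scalerBr.
  have := resolvent_diff ku kw (Gr_iter n ku xy); rewrite -/D => <-.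
  rewrite opprD !addrA; congr (_ - _).
  by rewrite [RHS]addrC !addrA addNr add0r [RHS]addrC addrA.
have e1 := iter_diff_le n.+1 ku kw yz; rewrite -/D in e1.
have e2 : N (D *: J w (iter n.+1 (J u) y - iter n.+1 (J w) y)) <=
    normc D * (n.+1%:R * normc D * N z).
  by rewrite (normZ NP) ler_wpM2l ?normc_ge0// (le_trans (rf_le JP _ kw) e1).
apply: le_trans (normD NP _ _) _.
apply: le_trans (lerD (le_trans (rf_le JP _ kw) IH) e2) _.
rewrite -subr_ge0.
have -> : (n.+1%:R * normc D) ^+ 2 * N z - ((n%:R * normc D) ^+ 2 * N z +
    normc D * (n.+1%:R * normc D * N z)) = n%:R * (normc D ^+ 2 * N z) :> R.
  by rewrite -natr1; ring.
by rewrite !mulr_ge0 ?exprn_ge0 ?normc_ge0 ?(norm_ge0 NP).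
Qed.

Lemma semigroup_taylor u w x y z : cone k u -> cone k w -> Gr x y -> Gr y z ->
  N (T u x - T w x - (u - w) *: T w y) <= normc (u - w) ^+ 2 * N z.
Proof.
move=> ku kw xy yz.
(* The linear term of [iter_taylor] has [n.+1] resolvents, one more than the Euler product; the
   extra one tends strongly to the identity. *)
have Jcvg l : cvgs N (fun j => J (w / (2 ^ j)%:R) l) l.
  move=> e e0; have [d d0 h] := resolvent_cvg0 l e0.
  exists (Num.truncn (normc w / d)) => n hn; apply: h; first exact: cone_div.
  rewrite normc_div ler_pdivrMr ?ltr0n ?expn_gt0// mulrC -ler_pdivrMr//.
  rewrite (le_trans (ltW (truncnS_gt _)))// ler_nat.
  by rewrite (leq_ltn_trans hn)// ltn_expl.
have cJ : cvgs N (fun j => J (w / (2 ^ j)%:R) (euler j w y)) (T w y).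
  apply: (cvgs_contractions NP _ (semigroup_cvg y kw) (Jcvg _)) => j v.
  by apply: (rf_le JP); exact: cone_div.
apply: (cvgs_norm_le NP (cvgsB NP (cvgsB NP (semigroup_cvg x ku)
  (semigroup_cvg x kw)) (cvgsZ NP (u - w) cJ))) => j /=.
have := iter_taylor (2 ^ j) (cone_div (2 ^ j) ku) (cone_div (2 ^ j) kw) xy yz.
have n0 : (2 ^ j)%:R != 0 :> R[i] by rewrite pnatr_eq0 -lt0n expn_gt0.
have n0' : (2 ^ j)%:R != 0 :> R by rewrite pnatr_eq0 -lt0n expn_gt0.
by rewrite -mulrBl normc_div ![(2 ^ j)%:R * _]mulrC !divfK.
Qed.

(** [semigroup_taylor] needs $G^2x$, so it is applied to an approximation from the core. The
    difference costs $(T(z) - 1)(x - x')$, which is itself of order $|z|$ by [semigroup_sub_le]. *)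
Lemma semigroup_generator x y e : Gr x y -> 0 < e -> exists2 d, 0 < d &
  forall z, cone k z -> normc z <= d -> N (T z x - x - z *: y) <= normc z * e.
Proof.
move=> xy e0; have e3 : 0 < e / 3 by rewrite divr_gt0.
have [x' [y' [u [xy' yu xx' yy']]]] := Gr_core xy e3.
have Nu : 0 < N u + 1 by rewrite ltr_wpDl// (norm_ge0 NP).
exists (e / 3 / (N u + 1)) => [|z kz zd]; first by rewrite divr_gt0.
have -> : T z x - x - z *: y = (T z (x - x') - (x - x')) +
    (T z x' - x' - z *: y') + z *: (y' - y).
  rewrite (raddfB (T z))/= scalerBr [RHS]addrA -(addrA _ _ (z *: y')) subrK.
  by rewrite addrACA subrK -opprD subrK.
have -> : normc z * e = normc z * (e / 3) + normc z * (e / 3) + normc z * (e / 3).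
  by field.
rewrite (le_trans (normD NP _ _))// lerD//; last first.
  by rewrite (normZ NP) ler_wpM2l ?normc_ge0// (norm_sym NP).
rewrite (le_trans (normD NP _ _))// lerD//.
  rewrite (le_trans (semigroup_sub_le kz (GrB xy xy')))//.
  by rewrite ler_wpM2l ?normc_ge0.
have := semigroup_taylor kz (@cone0 R k) xy' yu.
rewrite subr0 !semigroup_at0 => /le_trans; apply.
rewrite expr2 -mulrA ler_wpM2l ?normc_ge0//.
rewrite (le_trans (ler_wpM2r (norm_ge0 NP u) zd))//.
by rewrite mulrAC ler_pdivrMr// ler_wpM2l ?lerDl// ltW.
Qed.

Lemma cone1 : cone k 1.
Proof. exact: (cone_real k_gt0 ler01). Qed.

(* [1 - G] is onto and the generator is dissipative, so [G] has no proper
   extension among generators of contractions. *)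
Lemma generator_Gr x y :
  (forall e, 0 < e -> exists2 d, 0 < d & forall t : R, 0 < t -> t <= d ->
    N (T t%:C x - x - t%:C *: y) <= t * e) -> Gr x y.
Proof.
move=> xy; pose x' := J 1 (x - y); pose y' := x' - (x - y).
have xy' : Gr x' y'.
  by have := rf_graph JP (x - y) cone1 (oner_neq0 _); rewrite invr1 scale1r.
suff xx' : x = x' by rewrite xx' (_ : y = y')// /y' -xx' subKr.
apply/eqP; rewrite -subr_eq0; apply/eqP/(norm_small NP) => e e0.
have e2 : 0 < e / 2 by rewrite divr_gt0.
have [[d1 d10 h1] [d2 d20 h2]] := (xy _ e2, semigroup_generator xy' e2).
pose t := Num.min d1 d2; have t0 : 0 < t by rewrite lt_min d10.
have kt : cone k t%:C by apply: cone_real => //; exact: ltW.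
have td2 : normc t%:C <= d2 by rewrite (normc_real (ltW t0)) ge_min lexx orbT.
have td1 : t <= d1 by rewrite ge_min lexx.
have {h1 h2} := (h1 _ t0 td1, h2 _ kt td2); rewrite (normc_real (ltW t0)) => -[h1 h2].
(* Here [y - y'] equals [v], so [v] would be an eigenvector of the generator for the eigenvalue 1:
   $T(t)v$ is $(1+t)v$ up to $te$, against contractivity unless [v] is small. *)
pose v := x - x'.
have h3 : N (v + t%:C *: v - T t%:C v) <= t * e.
  have -> : v + t%:C *: v - T t%:C v =
    T t%:C x' - x' - t%:C *: y' - (T t%:C x - x - t%:C *: y).
    rewrite /v /y' (raddfB (T t%:C))/= !scalerBr.
    rewrite !opprB !addrA [RHS](ACl (7*1*2*3*5*8*(4*6)))/= addNr addr0.
    by rewrite [LHS](ACl (1*5*2*3*4*6)).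
  by rewrite (le_trans (normB NP _ _))// [e]splitr mulrDr lerD.
have h4 : (1 + t) * N v = N (v + t%:C *: v).
  have -> : v + t%:C *: v = (1 + t%:C) *: v by rewrite scalerDl scale1r.
  rewrite (normZ NP).
  by rewrite -(rmorphD (real_complex R)) normc_real// addr_ge0// ltW.
have h5 := le_trans (normD NP (v + t%:C *: v - T t%:C v) (T t%:C v))
  (lerD h3 (semigroup_le v kt)).
rewrite subrK -h4 mulrDl mul1r addrC lerD2r in h5.
by rewrite -(ler_pM2l t0).
Qed.
End Resolvents.

(** * Smoothing and holomorphy *)

(** With $d = 2^{-(n+1)}$, $nd \le 1/2$ and $(1+d)^m(1-dm) \le 1$ by induction. It keeps [n] nearly
    contractive factors bounded. *)
Lemma expr1D_le2 (R : realType) n : (1 + (2 ^+ n.+1)^-1) ^+ n <= 2 :> R.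
Proof.
pose d := (2 ^+ n.+1)^-1 : R; rewrite -/d.
have d0 : 0 <= d by rewrite invr_ge0 exprn_ge0.
have dn : d * n%:R <= 2^-1.
  rewrite /d exprS invfM -mulrA ler_piMr ?invr_ge0// ler_pdivrMl ?exprn_gt0//.
  by rewrite mulr1 -natrX ler_nat ltnW// ltn_expl.
have h m : (1 + d) ^+ m * (1 - d * m%:R) <= 1.
  elim: m => [|m IH]; first by rewrite expr0 mulr0 subr0 mulr1.
  apply: le_trans IH; rewrite exprSr -mulrA ler_wpM2l ?exprn_ge0 ?addr_ge0//.
  rewrite -subr_ge0 -natr1.
  have -> : 1 - d * m%:R - (1 + d) * (1 - d * (m%:R + 1)) = d ^+ 2 * (m%:R + 1).
    by ring.
  by rewrite mulr_ge0 ?exprn_ge0 ?addr_ge0.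
have := h n; have : 0 <= (1 + d) ^+ n by rewrite exprn_ge0 ?addr_ge0.
by nra.
Qed.

Section Smoothing.
Variables (R : realType) (V : lmodType R[i]) (N : V -> R) (k : R).
Variables (J : R[i] -> {linear V -> V}) (Gr : V -> V -> Prop).
Hypothesis NP : is_norm N.
Hypothesis JP : resolvent_family N k J Gr.

Let k_gt0 := rf_cone JP.

(* $G (1 - w G)^{-1}$ *)
Definition yosida w x : V := w^-1 *: (J w x - x).

Fact yosida_linear w : linear (yosida w).
Proof.
move=> a x y; rewrite /yosida linearP/= opprD addrACA -scalerBr scalerDr.
by rewrite !scalerA mulrC.
Qed.

HB.instance Definition _ w :=
  GRing.isLinear.Build R[i] V V *:%R (yosida w) (yosida_linear w).

Lemma yosida_comm w x : yosida w (J w x) = J w (yosida w x).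
Proof. by rewrite /yosida [RHS]linearZ/= [in RHS]raddfB. Qed.

Lemma yosida_le w x : cone k w -> normc w * N (yosida w x) <= 2 * N x.
Proof.
move=> kw; have [->|w0] := eqVneq w 0; first
  by rewrite normc0 mul0r mulr_ge0 ?(norm_ge0 NP).
rewrite /yosida (normZ NP) normcV mulrA mulfV ?gt_eqF ?normc_gt0// mul1r.
by rewrite (le_trans (normB NP _ _))// mulr_natl mulr2n lerD2r (rf_le JP).
Qed.

(* Partial sums of the Neumann series of [J (w + h)] around [w]. *)
Fixpoint resolvent_poly m w h x : V :=
  if m is m'.+1 then J w x + h *: resolvent_poly m' w h (yosida w x) else 0.

(** $(1 - (w+h)G)J_wx = x - hGJ_wx$, and $GJ_w$ is [yosida w]. *)
Lemma resolvent_perturb w h x : cone k w -> w != 0 -> cone k (w + h) ->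
  J (w + h) (x - h *: yosida w x) = J w x.
Proof.
move=> kw w0 kwh; rewrite -[RHS](rf_cancel JP kwh (rf_graph JP x kw w0)).
congr (J _ _); rewrite -/(yosida w x) scalerDl opprD addrA; congr (_ - _).
by rewrite /yosida scalerA mulfV// scale1r subKr.
Qed.

(** The finite geometric sum telescopes exactly, so it inherits the contractivity of [J (w + h)] up
    to the remainder, however many terms it has. *)
Lemma resolvent_polyE m w h x : cone k w -> w != 0 -> cone k (w + h) ->
  resolvent_poly m w h x = J (w + h) (x - h ^+ m *: iter m (yosida w) x).
Proof.
move=> kw w0 kwh; elim: m x => [|m IH] x.
  by rewrite expr0 scale1r subrr linear0.
rewrite [LHS]/= IH -(resolvent_perturb x kw w0 kwh) -iterSr.
rewrite -[h *: J _ _]linearZ -[LHS]linearD; congr (J _ _).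
by rewrite /= scalerBr addrA subrK scalerA -exprS.
Qed.

Lemma yosida_iter_le m w h x : cone k w -> w != 0 -> 4 * normc h <= normc w ->
  N (h ^+ m *: iter m (yosida w) x) <= (2 ^+ m)^-1 * N x.
Proof.
move=> kw w0 hw; elim: m => [|m IH].
  by rewrite !expr0 scale1r invr1 mul1r.
rewrite iterS exprS -scalerA -[h ^+ m *: _]linearZ (normZ NP).
set v := h ^+ m *: _ in IH *; rewrite -/v.
have Nw := normc_gt0 w0; have := yosida_le v kw.
have Nv := norm_ge0 NP v; have Ny := norm_ge0 NP (yosida w v).
have Nh := normc_ge0 h; rewrite exprS invfM -mulrA => yv.
have h1 : normc h * N (yosida w v) <= 2^-1 * N v.
  by nra.
by rewrite (le_trans h1)// ler_wpM2l ?invr_ge0.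
Qed.

Lemma resolvent_poly_le m w h x : cone k w -> w != 0 -> cone k (w + h) ->
  4 * normc h <= normc w ->
  N (resolvent_poly m w h x) <= (1 + (2 ^+ m)^-1) * N x.
Proof.
move=> kw w0 kwh hw; rewrite resolvent_polyE// (le_trans (rf_le JP _ kwh))//.
rewrite (le_trans (normB NP _ _))// mulrDl mul1r lerD2l.
exact: yosida_iter_le.
Qed.

Lemma polyfun_shift F (a b : V) : polyfun F a b -> polyfun (fun h => h *: F h) 0 a.
Proof. by move=> /(PolyCons 0); under eq_fun do rewrite add0r. Qed.

(** Only the coefficients of degree zero and one matter: one Neumann term settles the former, two
    settle the latter in [polyfun_resolvent_poly]. *)
Lemma polyfun_resolvent_poly0 m w F a b : polyfun F a b ->
  exists b', polyfun (fun h => resolvent_poly m.+1 w h (F h)) (J w a) b'.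
Proof.
elim: m F a b => [|m IH] F a b pF /=.
  exists (J w b); under eq_fun do rewrite scaler0 addr0.
  exact: polyfun_linear.
have [b' pb'] := IH _ _ _ (polyfun_linear (yosida w) pF).
have := polyfunD (polyfun_linear (J w) pF) (polyfun_shift pb').
by rewrite addr0 => h; exists (J w b + J w (yosida w a)).
Qed.

Lemma polyfun_resolvent_poly m w F a b : polyfun F a b ->
  polyfun (fun h => resolvent_poly m.+2 w h (F h)) (J w a)
    (J w b + J w (yosida w a)).
Proof.
move=> pF.
have [b' pb'] := polyfun_resolvent_poly0 m w (polyfun_linear (yosida w) pF).
by have := polyfunD (polyfun_linear (J w) pF) (polyfun_shift pb'); rewrite addr0.
Qed.

Lemma polyfun_iter n m w x :
  polyfun (fun h => iter n (resolvent_poly m.+2 w h) x) (iter n (J w) x)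
    (n%:R *: iter n (J w) (yosida w x)).
Proof.
elim: n => [|n IH]; first by rewrite scale0r; exact: polyfun_cst.
have := polyfun_resolvent_poly m w IH; rewrite /= linearZ/=.
have -> : J w (yosida w (iter n (J w) x)) = iter n.+1 (J w) (yosida w x).
  by rewrite iterS; congr (J w _); elim: n {IH} => //= n <-; rewrite yosida_comm.
by rewrite -[in X in _ -> X]natr1 scalerDl scale1r.
Qed.

Lemma resolvent_smoothing n w r x y : cone k w -> w != 0 -> 0 <= r ->
  4 * r <= normc w -> (forall h, normc h <= r -> cone k (w + h)) -> Gr x y ->
  r * (n%:R * N (iter n.+1 (J w) y)) <= 2 * N x.
Proof.
move=> kw w0 r0 rw rk xy.
have yK : J w y = yosida w x.
  by rewrite /yosida (resolventE JP kw xy) scalerA mulVf// scale1r.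
(* [cauchy_estimate] is about polynomials, so Neumann sums stand in for $J_{w+h}$. Their order
   [n.+3] grows with the power [n] so that [d ^+ n] stays below 2. *)
have pF := polyfun_iter n n.+1 w x; pose d := 1 + (2 ^+ n.+3)^-1 : R.
have d0 : 0 <= d by rewrite addr_ge0// invr_ge0 exprn_ge0.
have FM h : normc h <= r -> N (iter n (resolvent_poly n.+3 w h) x) <= d ^+ n * N x.
  move=> hr; elim: {1 3}n => [|j IH]; first by rewrite expr0 mul1r.
  rewrite iterS exprS -mulrA (le_trans (resolvent_poly_le _ _ kw w0 (rk _ hr) _))//.
    by rewrite (le_trans _ rw)// ler_wpM2l.
  exact: ler_wpM2l.
have := cauchy_estimate NP pF r0 FM.
rewrite (normZ NP) normc_nat iterSr yK => /le_trans; apply.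
rewrite ler_wpM2r ?(norm_ge0 NP)// (le_trans _ (expr1D_le2 R n))//.
rewrite lerXn2r ?nnegrE// ?addr_ge0 ?invr_ge0 ?exprn_ge0// lerD2l.
by rewrite lef_pV2 ?posrE ?exprn_gt0// ler_eXn2l ?ltr1n// leqW.
Qed.

Local Notation T := (semigroup NP JP).

(** The factor 4 makes [h] times [yosida w] a contraction by one half, as [yosida] has norm at most
    $2/|w|$. The condition is homogeneous, hence inherited by $z/n$ with radius $r/n$. *)
Definition cone_disk (z : R[i]) (r : R) : Prop :=
  [/\ 0 < r, 4 * r <= normc z & forall h, normc h <= r -> cone k (z + h)].

Lemma cone_disk_cone z r : cone_disk z r -> cone k z.
Proof. by case=> r0 _ /(_ 0); rewrite addr0 normc0; apply; exact: ltW. Qed.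

Lemma cone_disk_div n z r : (0 < n)%N -> cone_disk z r ->
  cone_disk (z / n%:R) (r / n%:R).
Proof.
move=> n0 [r0 rz rk]; have n0' : 0 < n%:R :> R by rewrite ltr0n.
split; first by rewrite divr_gt0.
  by rewrite normc_div mulrA ler_wpM2r// invr_ge0 ltW.
move=> h hr; have -> : z / n%:R + h = (z + n%:R * h) / n%:R.
  by field; rewrite pnatr_eq0 -lt0n.
apply/cone_div/rk; rewrite normcM normc_nat mulrC.
by rewrite -ler_pdivlMr.
Qed.

(** Apply [resolvent_smoothing] with $n = 2^j$ at $z/n$ with radius $r/n$: the factors $n$ cancel,
    so the bound is uniform in $j$. *)
Lemma semigroup_smoothing z r x y : cone_disk z r -> Gr x y ->
  N (T z y) <= 2 / r * N x.
Proof.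
move=> zr xy; have kz := cone_disk_cone zr; have [r0 rz rk] := zr.
have kzj j : cone k (z / (2 ^ j)%:R) by exact: cone_div.
have step j : N (J (z / (2 ^ j)%:R) (euler J j z y)) <= 2 / r * N x.
  have n0 : (0 < 2 ^ j)%N by rewrite expn_gt0.
  have [rj0 rjz rjk] := cone_disk_div n0 zr.
  have wj0 : z / (2 ^ j)%:R != 0.
    apply: contraTneq rjz => ->; rewrite normc0 -ltNge; lra.
  have := resolvent_smoothing (2 ^ j) (kzj j) wj0 (ltW rj0) rjz rjk xy.
  rewrite mulrA divfK ?pnatr_eq0 -?lt0n// => h.
  by rewrite mulrAC ler_pdivlMr// mulrC.
have zT := semigroup_cvg NP JP y kz.
apply: (cvgs_norm_le NP _ step).
apply: (cvgs_contractions NP _ zT) => [j v|]; first exact: (rf_le JP).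
move=> e e0; have [d d0 h] := resolvent_cvg0 NP JP (T z y) e0.
exists (Num.truncn (normc z / d)) => n hn; apply: h; first exact: cone_div.
rewrite normc_div ler_pdivrMr ?ltr0n ?expn_gt0// mulrC -ler_pdivrMr//.
rewrite (le_trans (ltW (truncnS_gt _)))// ler_nat.
by rewrite (leq_ltn_trans hn)// ltn_expl.
Qed.

(** For $u_n \to x$ in the domain, [semigroup_smoothing] makes $T(z)Gu_n$ a Cauchy sequence;
    closedness of the graph puts $T(z)x$ in the domain. *)
Lemma semigroup_range z r x : cone_disk z r ->
  exists v, Gr (T z x) v /\ N v <= 2 / r * N x.
Proof.
move=> zr; have kz := cone_disk_cone zr; have [r0 rz rk] := zr.
have c0 : 0 <= 2 / r by rewrite divr_ge0// ltW.
have [u u_] : {u : nat -> V * V | forall n, Gr (u n).1 (u n).2 /\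
    N (x - (u n).1) <= n.+1%:R^-1}.
  have : forall n : nat, {p : V * V | Gr p.1 p.2 /\ N (x - p.1) <= n.+1%:R^-1}.
    move=> n; apply: cid; have n0 : 0 < n.+1%:R^-1 :> R by rewrite invr_gt0 ltr0n.
    by have [x' [y' h]] := rf_dense JP x n0; exists (x', y').
  move=> f; exists (fun n => sval (f n)) => n; exact: (svalP (f n)).
have uG n : Gr (u n).1 (u n).2 by case: (u_ n).
have ux : cvgs N (fun n => (u n).1) x.
  apply: (cvgs_small NP (b := 1)) => n; rewrite (norm_sym NP) mul1r.
  by case: (u_ n).
have [v vT] : exists v, cvgs N (fun n => T z (u n).2) v.
  apply: (rf_complete JP) => e e0.
  have d0 : 0 < e / 2 / (2 / r) by rewrite !divr_gt0.
  have [n0 h] := ux _ d0; exists n0 => m n hm hn.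
  rewrite -linearB (le_trans (semigroup_smoothing zr (GrB JP (uG m) (uG n))))//.
  rewrite -ler_pdivlMl ?divr_gt0// (le_trans (norm_trans NP x _ _))//.
  rewrite [leRHS](_ : _ = e / 2 / (2 / r) + e / 2 / (2 / r)); last first.
    by field; rewrite gt_eqF.
  by rewrite lerD ?h// (norm_sym NP) h.
have Tx := cvgs_contraction (fun y => semigroup_le NP JP y kz) ux.
exists v; split.
  by apply: (Gr_cvgs NP JP Tx vT) => n; exact: (Gr_semigroup NP JP).
apply/ler_addgt0Pr => e e0.
have e2 : 0 < e / 2 by rewrite divr_gt0.
have d0 : 0 < e / 2 / (2 / r) by rewrite !divr_gt0.
have [[n1 h1] [n2 h2]] := (vT _ e2, ux _ d0); pose n := maxn n1 n2.
have {h1} h1 := h1 n (leq_maxl _ _); have {h2} h2 := h2 n (leq_maxr _ _).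
have h3 := semigroup_smoothing zr (uG n).
have h4 : N (u n).1 <= N x + e / 2 / (2 / r).
  by rewrite -[(u n).1](subrK x) addrC (le_trans (normD NP _ _))// lerD2l.
rewrite -[v](subKr (T z (u n).2)) (le_trans (normB NP _ _))//.
rewrite [e]splitr addrA (lerD _ h1)// (le_trans h3)// (le_trans (ler_wpM2l c0 h4))//.
by rewrite mulrDr lerD2l mulrCA mulfV ?mulr1// gt_eqF// divr_gt0.
Qed.

(** The derivative is $GT(z)$, picked by choice and linear because the graph is single-valued. *)
Lemma semigroup_holomorphic z r : cone_disk z r ->
  exists (D : {linear V -> V}) c, [/\ 0 <= c, forall x, N (D x) <= c * N x &
    forall h x, normc h <= r / 2 ->
      N (T (z + h) x - T z x - h *: D x) <= c * normc h ^+ 2 * N x].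
Proof.
move=> zr; have kz := cone_disk_cone zr; have [r0 rz rk] := zr.
pose D x := sval (cid (semigroup_range x zr)).
have DP x : Gr (T z x) (D x) /\ N (D x) <= 2 / r * N x.
  exact: (svalP (cid (semigroup_range x zr))).
have Dlin : linear D.
  move=> a x y; apply: (Gr_fun NP JP (proj1 (DP _))).
  rewrite linearP; apply: (rf_linear JP); [exact: (DP x).1|exact: (DP y).1].
pose Dl : {linear V -> V} := HB.pack D (GRing.isLinear.Build R[i] V V *:%R D Dlin).
have zr2 := cone_disk_div (isT : (0 < 2)%N) zr.
have zr4 := cone_disk_div (isT : (0 < 4)%N) zr.
have k2 := cone_disk_cone zr2; have k4 := cone_disk_cone zr4.
(* Two factors $T(z/4)$ put $T(z/2)x$ in the domain of $G^2$, with bound $(8/r)^2$. The other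
   $T(z/2)$ absorbs [h] through [semigroup_taylor]. *)
have E4 : z / 2 = z / 4 + z / 4 by field.
have E2 : z = z / 2 + z / 2 by field.
pose c := Num.max (2 / r) ((8 / r) ^+ 2).
have c1 : 2 / r <= c by rewrite le_max lexx.
have c2 : (8 / r) ^+ 2 <= c by rewrite le_max lexx orbT.
have c0 : 0 <= 2 / r by rewrite divr_ge0// ltW.
exists Dl, c; split; first exact: le_trans c1.
  by move=> x; rewrite (le_trans (DP x).2)// ler_wpM2r ?(norm_ge0 NP).
move=> h x hr.
have [v1 [xv1 v1x]] := semigroup_range x zr4.
have [v2 [xv2 v2x]] := semigroup_range v1 zr4.
have G1 : Gr (T (z / 2) x) (T (z / 4) v1).
  by rewrite E4 (semigroup_add NP JP)//; exact: (Gr_semigroup NP JP).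
have kh : cone k (z / 2 + h) by case: zr2 => _ _; apply.
have Dx : T (z / 2) (T (z / 4) v1) = D x.
  apply: (Gr_fun NP JP _ (DP x).1); rewrite [in T z x]E2 (semigroup_add NP JP)//.
  exact: (Gr_semigroup NP JP).
have := semigroup_taylor NP JP kh k2 G1 xv2.
rewrite Dx -!(semigroup_add NP JP)// [z / 2 + h + _]addrAC -E2.
rewrite [z / 2 + h - _]addrAC subrr add0r.
move=> /le_trans; apply; rewrite [leRHS]mulrAC [leRHS]mulrC.
rewrite ler_wpM2l ?exprn_ge0 ?normc_ge0//.
have E8 : 2 / (r / 4) = 8 / r by field; rewrite gt_eqF.
rewrite E8 in v1x v2x; rewrite (le_trans v2x)//.
have c8 : 0 <= 8 / r by rewrite divr_ge0// ltW.
rewrite (le_trans (ler_wpM2l c8 v1x))// mulrA -expr2.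
by rewrite ler_wpM2r ?(norm_ge0 NP).
Qed.

End Smoothing.

(** * Sectorial operators *)

Section Closure.
Variables (R : realType) (V : lmodType R[i]) (N : V -> R) (k : R).
Variables (G : V -> V -> Prop).

(* [G] is the graph of a linear operator, dissipative along every ray of the
   cone. *)
Record sectorial : Prop := Sectorial {
  sec_complete : forall u, cauchys N u -> exists l, cvgs N u l;
  sec_cone : 0 < k;
  sec_linear : forall a x y x' y', G x y -> G x' y' -> G (a *: x + x') (a *: y + y');
  sec_dense : forall x e, 0 < e -> exists x' y', G x' y' /\ N (x - x') <= e;
  sec_dissipative : forall w x y, cone k w -> G x y -> N x <= N (x - w *: y);
  sec_range : forall w f e, cone k w -> w != 0 -> 0 < e ->
    exists x y, G x y /\ N (f - (x - w *: y)) <= e }.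

Hypothesis NP : is_norm N.
Hypothesis GP : sectorial.

Definition Gcl (x y : V) : Prop := forall e, 0 < e ->
  exists x' y', [/\ G x' y', N (x - x') <= e & N (y - y') <= e].

Lemma Gcl_sub x y : G x y -> Gcl x y.
Proof. by move=> xy e e0; exists x, y; rewrite !subrr (norm0 NP) ltW. Qed.

Lemma Gcl_linear a x y x' y' : Gcl x y -> Gcl x' y' ->
  Gcl (a *: x + x') (a *: y + y').
Proof.
move=> xy xy' e e0; have e2 : 0 < e / 2 by rewrite divr_gt0.
have a0 : 0 < normc a + 1 by rewrite ltr_wpDl// normc_ge0.
have [x1 [y1 [g1 hx1 hy1]]] := xy _ (divr_gt0 e2 a0).
have [x2 [y2 [g2 hx2 hy2]]] := xy' _ e2.
have h u v : N (u - v) <= e / 2 / (normc a + 1) -> N (a *: u - a *: v) <= e / 2.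
  rewrite ler_pdivlMr// mulrC => uv; rewrite -scalerBr (normZ NP).
  by apply: le_trans uv; rewrite ler_wpM2r ?(norm_ge0 NP)// lerDl.
exists (a *: x1 + x2), (a *: y1 + y2); split; first exact: (sec_linear GP).
  by rewrite opprD addrACA (le_trans (normD NP _ _))// (splitr e) lerD ?h.
by rewrite opprD addrACA (le_trans (normD NP _ _))// (splitr e) lerD ?h.
Qed.

Lemma Gcl_closed x y : (forall e, 0 < e ->
  exists x' y', [/\ Gcl x' y', N (x - x') <= e & N (y - y') <= e]) -> Gcl x y.
Proof.
move=> xy e e0; have e2 : 0 < e / 2 by rewrite divr_gt0.
have [x1 [y1 [g1 hx1 hy1]]] := xy _ e2.
have [x2 [y2 [g2 hx2 hy2]]] := g1 _ e2.
exists x2, y2; split => //.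
  by rewrite (le_trans (norm_trans NP x1 _ _))// (splitr e) lerD.
by rewrite (le_trans (norm_trans NP y1 _ _))// (splitr e) lerD.
Qed.

Lemma Gcl_dissipative w x y : cone k w -> Gcl x y -> N x <= N (x - w *: y).
Proof.
move=> kw xy; apply/ler_addgt0Pr => e e0; have e3 : 0 < e / 3 by rewrite divr_gt0.
have w0 : 0 < normc w + 1 by rewrite ltr_wpDl// normc_ge0.
pose d := Num.min (e / 3) (e / 3 / (normc w + 1)).
have d0 : 0 < d by rewrite lt_min e3 divr_gt0.
have [x' [y' [g xx' yy']]] := xy _ d0.
have {}xx' : N (x - x') <= e / 3 by rewrite (le_trans xx')// ge_min lexx.
have {}yy' : N (w *: (y - y')) <= e / 3.
  have : N (y - y') <= e / 3 / (normc w + 1) by rewrite (le_trans yy')// ge_min lexx orbT.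
  rewrite ler_pdivlMr// mulrC (normZ NP); apply: le_trans.
  by rewrite ler_wpM2r ?(norm_ge0 NP)// lerDl.
have h := sec_dissipative GP kw g.
have h1 : N x <= N x' + e / 3.
  by rewrite -[x in leLHS](subrK x') addrC (le_trans (normD NP _ _))// lerD2l.
have h2 : N (x' - w *: y') <= N (x - w *: y) + (e / 3 + e / 3).
  have -> : x' - w *: y' = (x - w *: y) + (w *: (y - y') - (x - x')).
    rewrite scalerBr !opprB !addrA [RHS](ACl (5*4*(1*6)*(2*3)))/=.
    by rewrite subrr addNr !addr0.
  rewrite (le_trans (normD NP _ _))// lerD2l (le_trans (normB NP _ _))//.
  by rewrite addrC lerD.
lra.
Qed.

(** Density of the range becomes surjectivity: dissipativity bounds the inverse of $1 - wG$ by one,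
    so approximate solutions form a Cauchy sequence, and their limit is a solution for the
    closure. *)
Lemma Gcl_range w f : cone k w -> w != 0 -> exists x, Gcl x (w^-1 *: (x - f)).
Proof.
move=> kw w0; have Nw := normc_gt0 w0.
have [u uP] : {u : nat -> V * V | forall n, G (u n).1 (u n).2 /\
    N (f - ((u n).1 - w *: (u n).2)) <= n.+1%:R^-1}.
  have h : forall n : nat, {p : V * V | G p.1 p.2 /\
      N (f - (p.1 - w *: p.2)) <= n.+1%:R^-1}.
    move=> n; apply: cid; have n0 : 0 < n.+1%:R^-1 :> R by rewrite invr_gt0 ltr0n.
    by have [x' [y' ?]] := sec_range GP f kw w0 n0; exists (x', y').
  by exists (fun n => sval (h n)) => n; exact: (svalP (h n)).
pose g n := (u n).1 - w *: (u n).2.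
have gf : cvgs N g f.
  apply: (cvgs_small NP (b := 1)) => n; rewrite (norm_sym NP) mul1r.
  by case: (uP n).
have G_B n m : G ((u n).1 - (u m).1) ((u n).2 - (u m).2).
  have := sec_linear GP (-1) (proj1 (uP m)) (proj1 (uP n)).
  by rewrite !scaleN1r ![- _ + _]addrC.
have [x ux] : exists x, cvgs N (fun n => (u n).1) x.
  apply: (sec_complete GP) => e e0; have [n0 h] := gf _ (divr_gt0 e0 (ltr0Sn R 1)).
  exists n0 => m n hm hn.
  rewrite (le_trans (sec_dissipative GP kw (G_B m n)))//.
  have -> : (u m).1 - (u n).1 - w *: ((u m).2 - (u n).2) = g m - f + (f - g n).
    rewrite addrA subrK /g scalerBr !opprB.
    by rewrite !addrA [LHS](ACl (1*4*3*2)).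
  by rewrite (le_trans (normD NP _ _))// (splitr e) lerD ?h// (norm_sym NP) h.
exists x => e e0; pose d := Num.min e (normc w * e / 2).
have d0 : 0 < d by rewrite lt_min e0 divr_gt0// mulr_gt0.
have we2 : 0 < normc w * e / 2 by rewrite divr_gt0// mulr_gt0.
have [[n1 h1] [n2 h2]] := (ux _ d0, gf _ we2); pose n := maxn n1 n2.
have {}h1 := h1 n (leq_maxl _ _); have {}h2 := h2 n (leq_maxr _ _).
exists (u n).1, (u n).2; split; first by case: (uP n).
  by rewrite (norm_sym NP) (le_trans h1)// ge_min lexx.
have -> : w^-1 *: (x - f) - (u n).2 = w^-1 *: ((x - (u n).1) - (f - g n)).
  rewrite -[(u n).2 in LHS](scalerK w0) -scalerBr; congr (_ *: _).
  rewrite /g opprB !addrA [RHS](ACl (1*5*4*(2*3)))/= addNr addr0.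
  by rewrite addrAC.
rewrite (normZ NP) normcV ler_pdivrMl// (le_trans (normB NP _ _))//.
rewrite [leRHS]splitr lerD//; last by rewrite (norm_sym NP).
by rewrite (norm_sym NP) (le_trans h1)// ge_min lexx orbT.
Qed.

(** The identity is the true value at [w = 0] and a placeholder off the cone. *)
Definition resolvent_fun w f : V :=
  if cone k w && (w != 0) then xget 0 [set x | Gcl x (w^-1 *: (x - f))]%classic
  else f.

Lemma resolvent_graph w f : cone k w -> w != 0 ->
  Gcl (resolvent_fun w f) (w^-1 *: (resolvent_fun w f - f)).
Proof.
move=> kw w0; rewrite /resolvent_fun kw w0/=.
have [x xf] := Gcl_range f kw w0.
exact: (@xgetPex _ 0 [set x | Gcl x (w^-1 *: (x - f))]%classic (ex_intro _ x xf)).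
Qed.

Lemma resolvent_unique w f x y : cone k w -> w != 0 ->
  Gcl x (w^-1 *: (x - f)) -> Gcl y (w^-1 *: (y - f)) -> x = y.
Proof.
move=> kw w0 xf yf; have := Gcl_linear (-1) yf xf.
rewrite !scaleN1r -!scalerN -scalerDr opprB ![- y + _]addrC.
have -> : f - y + (x - f) = x - y.
  by rewrite addrC addrA subrK.
move/(Gcl_dissipative kw); rewrite scalerA mulfV// scale1r subrr (norm0 NP).
move=> h; apply/eqP; rewrite -subr_eq0; apply/eqP/(norm_eq0 NP)/eqP.
by rewrite eq_le h (norm_ge0 NP).
Qed.

Fact resolvent_linear w : linear (resolvent_fun w).
Proof.
move=> a f g; have [/andP[kw w0]|] := boolP (cone k w && (w != 0)); last first.
  by rewrite /resolvent_fun => /negPf ->.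
apply: (resolvent_unique kw w0 (resolvent_graph _ kw w0)).
have := Gcl_linear a (resolvent_graph f kw w0) (resolvent_graph g kw w0).
rewrite scalerA [a * _]mulrC -scalerA -scalerDr scalerBr.
by rewrite opprD [in X in _ -> X]addrACA.
Qed.

HB.instance Definition _ w :=
  GRing.isLinear.Build R[i] V V *:%R (resolvent_fun w) (resolvent_linear w).

Definition resolvent w : {linear V -> V} := resolvent_fun w.

Lemma resolvent_familyP : resolvent_family N k resolvent Gcl.
Proof.
split.
- exact: sec_complete.
- exact: sec_cone.
- by move=> x; rewrite /= /resolvent_fun eqxx andbF.
- move=> w x kw; have [->|w0] := eqVneq w 0.
    by rewrite /= /resolvent_fun eqxx andbF.
  rewrite (le_trans (Gcl_dissipative kw (resolvent_graph x kw w0)))//.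
  by rewrite scalerA mulfV// scale1r subKr.
- by move=> w x kw w0; exact: resolvent_graph.
- move=> w x y kw xy; have [->|w0] := eqVneq w 0.
    by rewrite scale0r subr0 /= /resolvent_fun eqxx andbF.
  apply: (resolvent_unique kw w0 (resolvent_graph _ kw w0)).
  by rewrite subKr scalerA mulVf// scale1r.
- exact: Gcl_linear.
- exact: Gcl_closed.
- move=> x e e0; have [x' [y' [xy' h]]] := sec_dense GP x e0.
  by exists x', y'; split => //; exact: Gcl_sub.
Qed.

End Closure.

(** * From an equivalent norm to the topology, and generation *)

Section EquivalentNorm.
Variables (R : realType) (V : normedModType R[i]) (N : V -> R) (c1 c2 : R).
Hypotheses (c1_gt0 : 0 < c1) (c2_gt0 : 0 < c2).
Hypothesis norm_le_N : forall x, `|x| <= (c1 * N x)%:C.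
Hypothesis N_le_norm : forall x, (N x)%:C <= c2%:C * `|x|.

Lemma nbhs_equiv_norm x (B : set V) :
  nbhs x B <-> exists2 e : R, 0 < e & forall y, N (x - y) <= e -> B y.
Proof.
split=> [/nbhs_ballP[e /= e0 eB]|[e e0 eB]].
  have eE : e = (complex.Re e)%:C by rewrite RRe_real// gtr0_real.
  have r0 : 0 < complex.Re e by rewrite -ltcR -eE.
  exists (complex.Re e / 2 / c1) => [|y xy]; first by rewrite !divr_gt0.
  apply: eB; rewrite -ball_normE/=; apply: le_lt_trans (norm_le_N _) _.
  rewrite eE ltcR; move: xy; rewrite ler_pdivlMr// mulrC => /le_lt_trans; apply.
  by rewrite ltr_pdivrMr// mulr2n ltr_pMr// ltrDl.
apply/nbhs_ballP; exists (e / c2)%:C => /=; first by rewrite ltcR divr_gt0.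
move=> y; rewrite -ball_normE/= => xy; apply: eB; rewrite -lecR.
apply: le_trans (N_le_norm _) _.
have c2C : 0 <= c2%:C by rewrite lecR ltW.
apply: le_trans (ler_wpM2l c2C (ltW xy)) _.
by rewrite -rmorphM lecR mulrCA mulfV ?mulr1// gt_eqF.
Qed.

End EquivalentNorm.

Lemma nbhs_normc (R : realType) (z : R[i]^o) (B : set R[i]^o) :
  nbhs z B <-> exists2 e : R, 0 < e & forall w, normc (z - w) <= e -> B w.
Proof.
apply: (@nbhs_equiv_norm R R[i]^o (@normc R) 1 1) => // x.
  by rewrite mul1r.
by rewrite mul1r.
Qed.

Lemma sector_cone_disk (R : realType) (k : R) : 0 < k ->
  exists2 delta : R, 0 < delta <= pi / 2 &
    forall z, sector delta z -> exists r, cone_disk k z r.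
Proof.
move=> k0; exists (atan (k / 2)).
  by rewrite (ltW (atan_ltpi2 _)) andbT -atan0 lt_atan// divr_gt0.
move=> z [r [t [r0 td ->]]].
have t2 : - (pi / 2) < t < pi / 2.
  by rewrite -ltr_norml (lt_trans td)// atan_ltpi2.
have ct := cos_gt0_pihalf t2.
have ttan : `|tan t| < k / 2.
  have tin : t \in `](- (pi / 2)), (pi / 2)[ by rewrite in_itv.
  have ain : atan (k / 2) \in `](- (pi / 2)), (pi / 2)[.
    by rewrite in_itv/= atan_gtNpi2 atan_ltpi2.
  have nin : - atan (k / 2) \in `](- (pi / 2)), (pi / 2)[.
    by rewrite in_itv/= ltrN2 atan_ltpi2 ltrNl atan_gtNpi2.
  move: td; rewrite !ltr_norml => /andP[t1 t2'].
  by rewrite -[k / 2]atanK -tanN !ltr_tan// t1 t2'.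
have st : `|sin t| <= k / 2 * cos t.
  have -> : sin t = tan t * cos t by rewrite /tan divfK// gt_eqF.
  by rewrite normrM (gtr0_norm ct) ler_wpM2r// ltW.
pose x := r * cos t; have x0 : 0 < x by rewrite mulr_gt0.
have y1 : `|r * sin t| <= k / 2 * x.
  by rewrite normrM (gtr0_norm r0) /x mulrCA ler_wpM2l// ltW.
have k1 : 0 < 1 + k by rewrite addr_gt0.
(* A disk of radius $xd$ stays in the cone as soon as $k/2 + d \le k(1 - d)$, that is $d(1+k) \le
   k/2$. Half of that also gives $4d \le 1$. *)
pose d := k / (4 * (1 + k)); have d0 : 0 < d by rewrite divr_gt0// mulr_gt0.
have dE : d * (1 + k) = k / 4 by rewrite /d; field; rewrite gt_eqF.
exists (x * d); split; first by rewrite mulr_gt0.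
  apply: le_trans (normc_Re _); rewrite /= (gtr0_norm x0).
  have : 4 * d <= 1 by nra.
  by nra.
move=> h hd; have := le_trans (normc_Re h) hd; have := le_trans (normc_Im h) hd.
case: h hd => [u v] _ /=; rewrite /cone/= -/x => hv; rewrite ler_norml => /andP[hu _].
rewrite (le_trans (ler_normD _ _))// (le_trans (lerD y1 hv))//.
have : k * (x - x * d) <= k * (x + u) by rewrite ler_wpM2l ?lerD2l// ltW.
apply: le_trans; rewrite -subr_ge0.
have -> : k * (x - x * d) - (k / 2 * x + x * d) = x * (k / 2 - d * (1 + k)) by field.
by rewrite dE mulr_ge0 ?ltW// subr_gt0 ltr_pM2l// ltf_pV2 ?posrE// ltr_nat.
Qed.

Section Generation.
Variables (R : realType) (V : normedModType R[i]) (N : V -> R) (c1 c2 k : R).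
Variable A : linop V.
Hypotheses (c1_gt0 : 0 < c1) (c2_gt0 : 0 < c2).
Hypothesis norm_le_N : forall x, `|x| <= (c1 * N x)%:C.
Hypothesis N_le_norm : forall x, (N x)%:C <= c2%:C * `|x|.
Hypothesis NP : is_norm N.
Hypothesis AP : sectorial N k (fun x y => graph A (x, y)).

Let nbhsN := nbhs_equiv_norm c1_gt0 c2_gt0 norm_le_N N_le_norm.

Lemma continuous_bounded (F : {linear V -> V}) (c : R) :
  0 <= c -> (forall x, N (F x) <= c * N x) -> continuous F.
Proof.
move=> c0 Fc x B /nbhsN[e e0 eB]; apply/nbhsN.
have c1' : 0 < c + 1 by rewrite ltr_wpDl.
exists (e / (c + 1)) => [|y xy]; first by rewrite divr_gt0.
apply: eB; rewrite -linearB (le_trans (Fc _))//.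
rewrite (le_trans (ler_wpM2l c0 xy))// mulrCA ler_piMr// ?(ltW e0)//.
by rewrite ler_pdivrMr// mul1r lerDl.
Qed.

Lemma closure_graphE (x y : V) : closure (graph A) (x, y) <->
  Gcl N (fun x y => graph A (x, y)) x y.
Proof.
split=> [xy e e0|xy B [[B1 B2] /= [xB1 yB2] BB]].
  have xe : nbhs x [set x' | N (x - x') <= e] by apply/nbhsN; exists e.
  have ye : nbhs y [set y' | N (y - y') <= e] by apply/nbhsN; exists e.
  pose Bx := [set x' | N (x - x') <= e]; pose By := [set y' | N (y - y') <= e].
  have [|[x' y'] [g [/= h1 h2]]] := xy (Bx `*` By); first by exists (Bx, By).
  by exists x', y'.
have /nbhsN[e1 e10 h1] := xB1.
have /nbhsN[e2 e20 h2] := yB2.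
have e0 : 0 < Num.min e1 e2 by rewrite lt_min e10.
have [x' [y' [g]]] := xy _ e0; rewrite !le_min => /andP[x1 _] /andP[_ y2].
by exists (x', y'); split => //; apply: BB; split; [exact: h1|exact: h2].
Qed.

Let JP := resolvent_familyP NP AP.
Local Notation T := (semigroup NP JP).

Lemma semigroup_cvg0N x e : 0 < e -> exists2 d, 0 < d &
  forall z, cone k z -> normc z <= d -> N (x - T z x) <= e.
Proof.
move=> e0; have e3 : 0 < e / 3 by rewrite divr_gt0.
have [x' [y [xy xx']]] := rf_dense JP x e3.
have Ny : 0 < N y + 1 by rewrite ltr_wpDl// (norm_ge0 NP).
exists (e / 3 / (N y + 1)) => [|z kz zd]; first by rewrite divr_gt0.
rewrite (norm_sym NP).
have -> : T z x - x = T z (x - x') + (T z x' - x') + (x' - x).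
  by rewrite [T z (_ - _)]raddfB/= !addrA !subrK.
have -> : e = e / 3 + e / 3 + e / 3 by field.
rewrite (le_trans (normD NP _ _))// lerD//; last by rewrite (norm_sym NP).
rewrite (le_trans (normD NP _ _))// lerD//.
  by rewrite (le_trans (semigroup_le NP JP _ _)).
rewrite (le_trans (semigroup_sub_le NP JP kz xy))//.
rewrite (le_trans (ler_wpM2r (norm_ge0 NP y) zd))//.
by rewrite mulrAC ler_pdivrMr// ler_wpM2l ?lerDl// ltW.
Qed.

Lemma semigroup_analyticP z r : cone_disk k z r ->
  exists2 D : {linear V -> V}, continuous D & forall e : R, 0 < e ->
    \forall h \near nbhs (0 : R[i]^o), forall x,
      `|T (z + h) x - T z x - h *: D x| <= e%:C * `|h| * `|x|.
Proof.
move=> zr; have [r0 _ _] := zr.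
have [D [c [c0 Dc Dh]]] := semigroup_holomorphic NP JP zr.
exists D => [|e e0]; first exact: (continuous_bounded c0).
have c' : 0 < c1 * c * c2 + 1 by rewrite ltr_wpDl// !mulr_ge0// ltW.
apply/nbhs_normc; exists (Num.min (r / 2) (e / (c1 * c * c2 + 1))).
  by rewrite lt_min !divr_gt0.
move=> h; rewrite sub0r normcN le_min => /andP[hr he] x.
apply: le_trans (norm_le_N _) _.
have H1 : c1 * N (T (z + h) x - T z x - h *: D x) <= c1 * (c * normc h ^+ 2 * N x).
  by rewrite ler_wpM2l ?Dh// ltW.
have H2 : c1 * (c * normc h ^+ 2 * N x) * c2 <= e * normc h * N x.
  rewrite [leLHS](_ : _ = (c1 * c * c2) * normc h * normc h * N x); last by ring.
  rewrite ler_wpM2r ?(norm_ge0 NP)// ler_wpM2r ?normc_ge0//.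
  move: he; rewrite ler_pdivlMr// mulrC; apply: le_trans.
  by rewrite ler_wpM2r ?normc_ge0// lerDl.
apply: (@le_trans _ _ ((e * normc h / c2 * N x)%:C)).
  rewrite lecR (le_trans H1)// [leRHS]mulrAC ler_pdivlMr//.
have -> : e%:C * `|h| * `|x| = (e * normc h / c2)%:C * (c2%:C * `|x|).
  by rewrite [RHS]mulrA -[in RHS]rmorphM divfK ?gt_eqF// [in RHS]rmorphM.
have q0 : 0 <= (e * normc h / c2)%:C.
  by rewrite ler0c divr_ge0 ?mulr_ge0 ?normc_ge0//; exact: ltW.
by rewrite [X in X <= _]rmorphM; exact: ler_wpM2l q0 _ _ (N_le_norm x).
Qed.

Lemma generatorP (x y : V) : generator T (x, y) <->
  Gcl N (fun x y => graph A (x, y)) x y.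
Proof.
have E (t : R) u v : 0 < t ->
    v - (t%:C)^-1 *: (T t%:C u - u) = - ((t%:C)^-1 *: (T t%:C u - u - t%:C *: v)).
  move=> t0; rewrite [in RHS]scalerBr scalerK ?opprB//.
  by rewrite eq_complex/= eqxx andbT gt_eqF.
have NE (t : R) u v : 0 < t ->
    N (v - (t%:C)^-1 *: (T t%:C u - u)) = N (T t%:C u - u - t%:C *: v) / t.
  move=> t0; rewrite E// (normN NP) (normZ NP) normcV normc_real ?ltW//.
  by rewrite mulrC.
split=> [xy|xy].
  apply: (generator_Gr (NP := NP) (JP := JP)) => e e0.
  have ye : nbhs y [set y' | N (y - y') <= e] by apply/nbhsN; exists e.
  have /nbhs_ballP[d /= d0 dB] := xy _ ye.
  exists (d / 2) => [|t t0 td]; first by rewrite divr_gt0.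
  have := dB t _ t0; rewrite /= NE// ler_pdivrMr// mulrC; apply.
  rewrite -ball_normE/= sub0r normrN gtr0_norm// (le_lt_trans td)//.
  by rewrite ltr_pdivrMr// mulr2n ltr_pMr// ltrDl.
move=> B /nbhsN[e e0 eB].
have [d d0 h] := semigroup_generator NP JP xy e0.
apply/nbhs_ballP; exists d => //= t; rewrite -ball_normE/= sub0r normrN => td t0.
apply: eB; rewrite NE// ler_pdivrMr// mulrC.
rewrite gtr0_norm// in td; have := h t%:C; rewrite normc_real ?(ltW t0)//; apply.
  by apply: (cone_real (sec_cone AP)); exact: ltW.
exact: ltW.
Qed.

Theorem sectorial_generates_analytic_semigroup : generates_analytic_semigroup A.
Proof.
have [delta delta0 sd] := sector_cone_disk (sec_cone AP).
have sc z : sector delta z -> cone k z by move=> /sd[r /cone_disk_cone].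
exists T; last first.
  apply/seteqP; split => -[x y].
    by move=> /generatorP /closure_graphE.
  by move=> /closure_graphE /generatorP.
exists delta => //; split.
- move=> z /sc kz; apply: (continuous_bounded ler01) => x.
  by rewrite mul1r (semigroup_le NP JP).
- exact: semigroup_at0.
- by move=> z w x /sc kz /sc kw; exact: semigroup_add.
- move=> x B /nbhsN[e e0 eB].
  have [d d0 h] := semigroup_cvg0N x e0.
  apply/nbhs_normc; exists d => // z; rewrite sub0r normcN => zd /sc kz.
  exact/eB/h.
- by move=> z /sd[r zr]; exact: semigroup_analyticP zr.
Qed.

End Generation.

(** * Real-valued norms and estimates for quadratic forms *)

Section RealNorm.
Variable R : realType.

Definition rnorm (W : normedModType R[i]) (x : W) : R := complex.Re `|x|.

Variable W : normedModType R[i].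
Implicit Types x y : W.

Lemma rnormE x : `|x| = (rnorm x)%:C.
Proof. by rewrite /rnorm RRe_real// ger0_real. Qed.

Lemma rnormP : is_norm (@rnorm W).
Proof.
split=> [x y|a x|x].
- by have := ler_normD x y; rewrite !rnormE -rmorphD lecR.
- by have := normrZ a x; rewrite !rnormE normr_normc -rmorphM => /complexI.
- by move=> x0; apply/normr0_eq0; rewrite rnormE x0.
Qed.

End RealNorm.

Lemma rnorm_complete (R : realType) (W : completeNormedModType R[i]) (u : nat -> W) :
  cauchys (@rnorm R W) u -> exists l, cvgs (@rnorm R W) u l.
Proof.
move=> uc; have : cvgn u.
  apply: cauchy_cvg; apply/cauchyP => e e0.
  have eE : e = (complex.Re e)%:C by rewrite RRe_real// gtr0_real.
  have r0 : 0 < complex.Re e by rewrite -ltcR -eE.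
  have [n0 h] := uc _ (divr_gt0 r0 (ltr0Sn R 1)).
  exists (u n0); exists n0 => // n /= hn; rewrite -ball_normE/= rnormE eE ltcR.
  by rewrite (le_lt_trans (h _ _ (leqnn n0) hn))// ltr_pdivrMr// mulr2n ltr_pMr// ltrDl.
move=> ul; exists (lim (u @ \oo)) => e e0.
have eC : 0 < e%:C by rewrite ltcR.
have /cvgrPdist_lt/(_ _ eC)[n0 _ h] := ul; exists n0 => n hn.
by rewrite -lecR -rnormE distrC; exact/ltW/(h n hn).
Qed.

Lemma dense_rnorm (R : realType) (W : normedModType R[i]) (S : set W) x e :
  dense S -> 0 < e -> exists2 y, S y & rnorm (x - y) <= e.
Proof.
move=> dS e0; have eC : 0 < e%:C by rewrite ltcR.
have [] := dS (ball x e%:C); [by exists x; exact: ballxx|exact: ball_open|].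
move=> y []; rewrite -ball_normE/= => /ltW xy Sy; exists y => //.
by rewrite -lecR -rnormE.
Qed.

Section NormComparison.
Variables (R : realType) (V : lmodType R[i]) (M N : V -> R) (c : R).
Hypothesis c0 : 0 < c.
Hypothesis MN : forall x, M x <= c * N x.

Lemma cauchys_le u : cauchys N u -> cauchys M u.
Proof.
move=> uc e e0; have [n0 h] := uc _ (divr_gt0 e0 c0); exists n0 => m n hm hn.
by rewrite (le_trans (MN _))// -ler_pdivlMl// mulrC h.
Qed.

End NormComparison.

Section Dot.
Variables (R : realType) (U : lmodType R[i]) (f : {dot U for conjC}).

Lemma dotNl x z : f (- x) z = - f x z.
Proof. by rewrite -scaleN1r dotZl mulN1r. Qed.

Lemma dotBl x y z : f (x - y) z = f x z - f y z.
Proof. by rewrite dotDl dotNl. Qed.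

Lemma dotBr x y z : f z (x - y) = f z x - f z y.
Proof. by rewrite -scaleN1r dotDr dotZr rmorphN rmorph1 mulN1r. Qed.

Definition dnorm2 (x : U) : R := complex.Re (f x x).

Lemma dnorm2E x : f x x = (dnorm2 x)%:C.
Proof. by rewrite /dnorm2 RRe_real// ger0_real// dot_ge0. Qed.

Lemma dnorm2_ge0 x : 0 <= dnorm2 x.
Proof. by rewrite -ler0c -dnorm2E dot_ge0. Qed.

(** $\|y - wz\|^2 = \|y\|^2 - 2\,\mathrm{Re}(w\langle z,y\rangle) + |w|^2\|z\|^2$. *)
Lemma dissipative_le (w : R[i]) y z : complex.Re (w * f z y) <= 0 ->
  dnorm2 y <= dnorm2 (y - w *: z).
Proof.
move=> h; have z0 := dnorm2_ge0 z.
have E : f (y - w *: z) (y - w *: z) =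
    f y y - w * f z y - (w * f z y)^* + w * w^* * f z z.
  rewrite -scaleNr !(dotDl, dotDr, dotZl, dotZr) (dot_sym f y z) rmorphM rmorphN/=.
  ring.
rewrite {2}/dnorm2 E !dnorm2E.
move: (w * f z y) h (dnorm2 y) (dnorm2 z) z0 => [s t] /= h p q q0.
case: w {E} => u v /=; simpc; nra.
Qed.

End Dot.

(* The quadratic form [- Re <G x, x>] controls [|Im <G x, x>|]; here [p], [q],
   [r] stand for the norms of $\mathcal A^{1/2} x_1$, $\mathcal A^{1/2} w$,
   $\mathcal A^{1/2} x_3$ with $w = x_2 + \varepsilon x_1$. *)
Lemma sectorial_arith (R : realType) (b c C e : R) :
  0 < b -> 0 < c -> 1 <= C -> 0 < e ->
  e * b <= c ^+ 2 / 2 -> e * C ^+ 2 <= b / 4 ->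
  exists2 k : R, 0 < k & forall p q r m t u1 u2 v1 v2 x y : R,
    0 <= p -> 0 <= q -> 0 <= r -> 0 <= m -> m <= C * q ->
    `|t| <= p * q -> `|u1| <= C ^+ 2 * r * q -> `|u2| <= C ^+ 2 * r * q ->
    `|v1| <= C ^+ 2 * p * q -> `|v2| <= C ^+ 2 * p * q ->
    `|y| <= k * x ->
    x * (- ((c ^+ 2 - b * e) * e * p ^+ 2) - b * q ^+ 2 - 2 * C ^+ 4 / b * r ^+ 2 +
         e * m ^+ 2 + u1 - e ^+ 2 * v1) -
    y * (- 2 * (c ^+ 2 - b * e) * t + u2 - e ^+ 2 * v2) <= 0.
Proof.
move=> b0 c0 C1 e0 h1 h2; pose al := c ^+ 2 - b * e.
have c20 : 0 < c ^+ 2 by rewrite exprn_gt0.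
have al0 : c ^+ 2 / 2 <= al by rewrite /al; lra.
have al_gt0 : 0 < al by lra.
have C20 : 1 <= C ^+ 2 by rewrite exprn_ege1.
pose D := 2 * al + C ^+ 2 + e ^+ 2 * C ^+ 2.
have e20 : 0 < e ^+ 2 by rewrite exprn_gt0.
have D0 : 0 < D by rewrite /D; nra.
(* These are the coefficients of $p^2$, $q^2$, $r^2$ that remain in [S] after the terms in [m],
   [u1], [v1] have taken their share. So $S \le -lQ$, and with $|I| \le DQ$ the aperture $k = l/D$
   works. *)
pose l := Num.min (al * e / 2) (Num.min (b / 4) (C ^+ 4 / b)).
have C40 : 0 < C ^+ 4 / b by rewrite divr_gt0// exprn_gt0//; lra.
have l0 : 0 < l by rewrite !lt_min C40 !divr_gt0// ?mulr_gt0.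
have l1 : l <= al * e / 2 by rewrite ge_min lexx.
have l2 : l <= b / 4 by rewrite !ge_min lexx orbT.
have l3 : l <= C ^+ 4 / b by rewrite !ge_min lexx !orbT.
exists (l / D) => [|p q r m t u1 u2 v1 v2 x y p0 q0 r0 m0 mq tb u1b u2b v1b v2b yx].
  by rewrite divr_gt0.
have x0 : 0 <= x.
  by rewrite -(pmulr_rge0 x (divr_gt0 l0 D0)) (le_trans _ yx).
set S := - _ - _ - _ + _ + _ - _; set I := - 2 * _ * _ + _ - _.
pose Q := p ^+ 2 + q ^+ 2 + r ^+ 2.
have p2 := sqr_ge0 p; have q2 := sqr_ge0 q; have r2 := sqr_ge0 r.
have Q0 : 0 <= Q by rewrite /Q !addr_ge0.
have SQ : S <= - (l * Q).
  have A1 : e * m ^+ 2 <= b / 4 * q ^+ 2.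
    have : m ^+ 2 <= C ^+ 2 * q ^+ 2 by rewrite -exprMn lerXn2r ?nnegrE// (le_trans m0).
    by nra.
  have A2 : u1 <= b / 4 * q ^+ 2 + C ^+ 4 / b * r ^+ 2.
    have : u1 <= C ^+ 2 * r * q by rewrite (le_trans (ler_norm _)).
    have : 0 <= (b / 2 * q - C ^+ 2 * r) ^+ 2 / b by rewrite divr_ge0 ?sqr_ge0// ltW.
    have -> : (b / 2 * q - C ^+ 2 * r) ^+ 2 / b =
      b / 4 * q ^+ 2 - C ^+ 2 * r * q + C ^+ 4 / b * r ^+ 2 by field; rewrite gt_eqF.
    lra.
  have A3 : - (e ^+ 2 * v1) <= al * e / 2 * p ^+ 2 + b / 4 * q ^+ 2.
    have hv : - v1 <= C ^+ 2 * p * q by rewrite (le_trans (ler_norm _))// normrN.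
    have hv' : - (e ^+ 2 * v1) <= e ^+ 2 * (C ^+ 2 * p * q).
      by rewrite -mulrN ler_wpM2l// ltW.
    have ec : e ^+ 2 * (C ^+ 2 * p * q) <= e * (b / 4) * (p * q).
      have -> : e ^+ 2 * (C ^+ 2 * p * q) = e * (e * C ^+ 2) * (p * q) by ring.
      by rewrite ler_wpM2r ?mulr_ge0// ler_wpM2l// ltW.
    have eb : e * (b / 4) * (p * q) <= b / 4 * q ^+ 2 + e ^+ 2 * b / 16 * p ^+ 2.
      have : 0 <= b / 4 * (q - e / 2 * p) ^+ 2.
        by rewrite mulr_ge0 ?sqr_ge0// divr_ge0// ltW.
      have -> : b / 4 * (q - e / 2 * p) ^+ 2 =
        b / 4 * q ^+ 2 - e * (b / 4) * (p * q) + e ^+ 2 * b / 16 * p ^+ 2 by field.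
      lra.
    have : e ^+ 2 * b / 16 * p ^+ 2 <= al * e / 2 * p ^+ 2.
      rewrite ler_wpM2r// expr2 -mulrA.
      have : e * b / 16 <= al / 2 by lra.
      by nra.
    lra.
  have L1 : l * p ^+ 2 <= al * e / 2 * p ^+ 2 by rewrite ler_wpM2r.
  have L2 : l * q ^+ 2 <= b / 4 * q ^+ 2 by rewrite ler_wpM2r.
  have L3 : l * r ^+ 2 <= C ^+ 4 / b * r ^+ 2 by rewrite ler_wpM2r.
  rewrite /S -/al /Q.
  have -> : 2 * C ^+ 4 / b * r ^+ 2 = C ^+ 4 / b * r ^+ 2 + C ^+ 4 / b * r ^+ 2 by ring.
  lra.
have IQ : `|I| <= D * Q.
  have pq : p * q <= Q by rewrite /Q; have := sqr_ge0 (p - q); nra.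
  have rq : r * q <= Q by rewrite /Q; have := sqr_ge0 (r - q); nra.
  have B1 : `|- 2 * al * t| <= 2 * al * Q.
    rewrite !normrM normrN normr_nat (gtr0_norm al_gt0) ler_wpM2l ?(le_trans tb)//.
    by rewrite mulr_ge0// ltW.
  have B2 : `|u2| <= C ^+ 2 * Q.
    by rewrite (le_trans u2b)// -mulrA ler_wpM2l//; lra.
  have B3 : `|e ^+ 2 * v2| <= e ^+ 2 * C ^+ 2 * Q.
    rewrite normrM gtr0_norm// -mulrA ler_wpM2l ?(ltW e20)// (le_trans v2b)//.
    by rewrite -mulrA ler_wpM2l//; lra.
  have -> : D * Q = 2 * al * Q + C ^+ 2 * Q + e ^+ 2 * C ^+ 2 * Q by rewrite /D; ring.
  rewrite /I -/al (le_trans (ler_normB _ _))// lerD//.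
  by rewrite (le_trans (ler_normD _ _))// lerD.
have yI : - (y * I) <= l / D * x * (D * Q).
  rewrite (le_trans (ler_norm _))// normrN normrM ler_pM//.
have E : l / D * x * (D * Q) = x * (l * Q) by field; rewrite gt_eqF.
have : x * S <= x * - (l * Q) by rewrite ler_wpM2l.
rewrite mulrN; lra.
Qed.

(** * The square root *)

Lemma linopB (K : nzRingType) (V : lmodType K) (A : linop V) x y :
  x \in dom A -> y \in dom A -> A (x - y) = A x - A y.
Proof. by move=> xA yA; rewrite addrC -scaleN1r linopP// scaleN1r addrC. Qed.

Section SquareRoot.
Variables (R : realType) (H : completeNormedModType R[i]) (ip : {dot H for conjC}).
Hypothesis ip_norm : forall x, `|x| ^+ 2 = ip x x.
Variables (A : pos_self_adjoint ip) (B : pos_sqrt A).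

Local Notation hn := (@rnorm R H).

Lemma ip_rnorm x : ip x x = (hn x ^+ 2)%:C.
Proof. by rewrite -ip_norm rnormE rmorphXn. Qed.

Lemma ip_le x y : normc (ip x y) <= hn x * hn y.
Proof.
have E z : dot_norm ip z = (hn z)%:C.
  by rewrite /dot_norm -ip_norm sqrCK// rnormE.
by have := dot_CS ip x y; rewrite !E normr_normc -rmorphM lecR.
Qed.

Lemma ip_Re_le x y : `|complex.Re (ip x y)| <= hn x * hn y.
Proof. exact: le_trans (normc_Re _) (ip_le _ _). Qed.

Lemma ip_Im_le x y : `|complex.Im (ip x y)| <= hn x * hn y.
Proof. exact: le_trans (normc_Im _) (ip_le _ _). Qed.

Lemma sqrt_sym x y : x \in dom B -> y \in dom B -> ip (B x) y = ip x (B y).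
Proof.
move=> xB yB; have [_ aB] := sqrt_self_adjoint B.
have : graph B (y, B y) by [].
by rewrite -aB => /(_ x xB).
Qed.

(** [B] equals its adjoint, so membership in its graph is the identity $\langle Bz,x\rangle =
    \langle z,y\rangle$ for all $z$ in the domain, which passes to limits. *)
Lemma sqrt_closed (u : nat -> H) x y : (forall n, u n \in dom B) ->
  cvgs hn u x -> cvgs hn (fun n => B (u n)) y -> x \in dom B /\ B x = y.
Proof.
move=> uB ux uy; have [_ aB] := sqrt_self_adjoint B.
suff : graph B (x, y) by [].
rewrite -aB => z zB /=; apply/eqP; rewrite -subr_eq0; apply/eqP/eq0_normc.
have hnP := @rnormP R H.
apply/eqP; rewrite eq_le normc_ge0 andbT; apply/ler_addgt0Pr => e e0.
have z0 : 0 < hn z + 1 by rewrite ltr_wpDl// (norm_ge0 hnP).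
have Bz0 : 0 < hn (B z) + 1 by rewrite ltr_wpDl// (norm_ge0 hnP).
have e2 : 0 < e / 2 by rewrite divr_gt0.
have [n1 h1] := ux _ (divr_gt0 e2 Bz0); have [n2 h2] := uy _ (divr_gt0 e2 z0).
pose n := maxn n1 n2; have {}h1 := h1 n (leq_maxl _ _).
have {}h2 := h2 n (leq_maxr _ _); rewrite add0r.
have -> : ip (B z) x - ip z y = ip z (B (u n) - y) - ip (B z) (u n - x).
  rewrite !dotBr (sqrt_sym zB (uB n)) opprB.
  by rewrite [RHS]addrC addrA subrK.
have step p q : 0 < hn p + 1 -> hn q <= e / 2 / (hn p + 1) ->
    normc (ip p q) <= e / 2.
  move=> p0 pq; rewrite (le_trans (ip_le _ _))//.
  rewrite (le_trans (ler_wpM2l (norm_ge0 hnP p) pq))// mulrA.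
  by rewrite ler_pdivrMr// mulrC ler_wpM2l ?lerDl// ltW.
have t1 : normc (ip z (B (u n) - y)) <= e / 2 by exact: step.
have t2 : normc (ip (B z) (u n - x)) <= e / 2 by exact: step.
rewrite [e]splitr (le_trans (le_normcD _ _))// lerD//.
by rewrite normcN.
Qed.

Variable C1 : R.
Hypothesis bound1 : forall v, v \in dom B -> `|v| <= C1%:C * `|B v|.

Lemma sqrt_bound v : v \in dom B -> hn v <= Num.max 1 C1 * hn (B v).
Proof.
move=> /bound1; rewrite !rnormE -rmorphM lecR => /le_trans; apply.
by rewrite ler_wpM2r ?(norm_ge0 (rnormP H))// le_max lexx orbT.
Qed.

Variable mu : R.
Hypothesis mu_min : forall l, spectrum A l -> mu%:C <= l.
Hypothesis mu_gt0 : 0 < mu.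

(** In the order of [R[i]], [mu%:C <= l] forces [l] to be real; so this covers every nonreal [l] as
    well as the reals below [mu]. *)
Lemma resolventP l : ~~ (mu%:C <= l) ->
  forall y, exists2 x, x \in dom A & l *: x - A x = y.
Proof.
move=> ml y; have : resolvent_set A l.
  by apply: contrapT => /mu_min; apply/negP.
by case=> S [_ h _]; have [h1 h2] := h y; exists (S y).
Qed.

Lemma op_surj y : exists2 x, x \in dom A & A x = y.
Proof.
have [|x xA h] := resolventP (l := 0) _ (- y).
  by rewrite lecR -ltNge.
by exists x => //; move: h; rewrite scale0r sub0r => /oppr_inj.
Qed.

Lemma shift_surj (s : R[i]) y : s != 0 -> (forall t, 0 < t -> s != - t%:C) ->
  exists2 x, x \in dom A & x + s *: A x = y.
Proof.
move=> s0 sN; pose l := - s^-1.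
have ls : - s * l = 1 by rewrite /l mulrNN mulfV.
have [|x xA h] := resolventP (l := l) _ (l *: y).
  apply/negP; rewrite lecE => /andP[/= /eqP l0 lmu].
  have lr : l = (complex.Re l)%:C.
    by rewrite [LHS]complexE l0 mulr0 addr0.
  have l1 : 0 < (complex.Re l)^-1 by rewrite invr_gt0 (lt_le_trans mu_gt0 lmu).
  have /negP := sN _ l1.
  by apply; rewrite fmorphV/= -lr /l invrN invrK opprK.
exists x => //; have := congr1 (fun v => - s *: v) h.
by rewrite scalerBr !scalerA ls !scale1r scaleNr opprK.
Qed.

(** $\mathcal D(\mathcal A)$ is a core of [B]: approximate [B x] by [v] in the dense domain of [B]
    and solve $\mathcal Ax' = Bv$; injectivity of [B] gives $Bx' = v$. *)
Lemma dom_sqrt_dense x e : x \in dom B -> 0 < e ->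
  exists2 x', x' \in dom A & hn (B x' - B x) <= e.
Proof.
move=> xB e0; have [dB _] := sqrt_self_adjoint B.
have [v vB vx] := dense_rnorm (B x) dB e0.
have [x' x'A Ax'] := op_surj (B v).
have x'B := sqrt_dom_sub B x'A.
have Bx'B : B x' \in dom B by move: x'A; rewrite (sqrt_domE B) => /andP[].
exists x' => //.
suff -> : B x' = v by rewrite (norm_sym (rnormP H)).
apply/eqP; rewrite -subr_eq0; apply/eqP.
have BB := sqrt_sqr B x'A.
have BvB : B x' - v \in dom B by rewrite -scaleN1r rpredD ?rpredZ.
apply: (sqrt_inj0 BvB).
by rewrite linopB// BB Ax' subrr.
Qed.

End SquareRoot.

(** * The energy norm *)

Section EnergyNorm.
Variables (R : realType) (H : completeNormedModType R[i]) (ip : {dot H for conjC}).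
Hypothesis ip_norm : forall x, `|x| ^+ 2 = ip x x.
Variables (A : pos_self_adjoint ip) (B : pos_sqrt A).

Local Notation hn := (@rnorm R H).
Let hnP := @rnormP R H.

Lemma rnorm_H1 (x : H1 B) :
  rnorm x ^+ 2 = hn (B (val x.1.1)) ^+ 2 + hn x.1.2 ^+ 2 + hn x.2 ^+ 2.
Proof.
apply: complexI; rewrite rmorphXn/= -rnormE.
rewrite [LHS](dot_normE (ip1 B) x) /= /ipH1 !(ip_rnorm ip_norm).
by rewrite !rmorphD.
Qed.

(** A go-between for [rnorm] and [energy]: being linear in the component norms, it avoids square
    roots in comparisons. *)
Definition l1norm (x : H1 B) : R := hn (B (val x.1.1)) + hn x.1.2 + hn x.2.

Lemma rnorm_le_l1norm x : rnorm x <= l1norm x.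
Proof.
have p0 := norm_ge0 hnP (B (val x.1.1)); have q0 := norm_ge0 hnP x.1.2.
have r0 := norm_ge0 hnP x.2.
rewrite -(@ler_pXn2r _ 2)// ?nnegrE ?(norm_ge0 (rnormP _)) ?addr_ge0//.
rewrite rnorm_H1 /l1norm; nra.
Qed.

Lemma l1norm_le_rnorm x : l1norm x <= 3 * rnorm x.
Proof.
have p0 := norm_ge0 hnP (B (val x.1.1)); have q0 := norm_ge0 hnP x.1.2.
have r0 := norm_ge0 hnP x.2; have n0 := norm_ge0 (@rnormP R (H1 B)) x.
have E := rnorm_H1 x.
have h z : 0 <= z -> z ^+ 2 <= rnorm x ^+ 2 -> z <= rnorm x.
  by move=> z0; rewrite ler_pXn2r ?nnegrE.
have sq (z : R) := sqr_ge0 z.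
have h1 : hn (B (val x.1.1)) <= rnorm x by apply: h => //; rewrite E -addrA lerDl addr_ge0.
have h2 : hn x.1.2 <= rnorm x by apply: h => //; rewrite E addrAC lerDr addr_ge0.
have h3 : hn x.2 <= rnorm x by apply: h => //; rewrite E lerDr addr_ge0.
rewrite /l1norm; lra.
Qed.

Variables (al K eps : R).
Hypotheses (al_gt0 : 0 < al) (K_gt0 : 0 < K) (eps_gt0 : 0 < eps).

(* The energy norm is the norm of [H1] in the coordinates
   $(x_1, x_2 + \varepsilon x_1, x_3)$, with weights. *)
Definition energy_map (x : H1 B) : H1 B :=
  (((sqrtr al)%:C *: x.1.1, x.1.2 + eps%:C *: val x.1.1), (sqrtr K)%:C *: x.2).

Fact energy_map_linear : linear energy_map.
Proof.
move=> k [[x1 x2] x3] [[y1 y2] y3].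
transitivity (energy_map ((k *: x1 + y1, k *: x2 + y2), k *: x3 + y3)); first by [].
rewrite /energy_map/=; congr (_, _, _).
- by rewrite [LHS]scalerDr scalerA [_ * k]mulrC -scalerA.
- rewrite /= [_ *: (_ + _)]scalerDr scalerA [_ * k]mulrC -scalerA addrACA.
  by rewrite -scalerDr.
- by rewrite [LHS]scalerDr scalerA [_ * k]mulrC -scalerA.
Qed.

HB.instance Definition _ :=
  GRing.isLinear.Build R[i] (H1 B) (H1 B) *:%R energy_map energy_map_linear.

Definition energy (x : H1 B) : R := rnorm (energy_map x).

Lemma energyE x : energy x ^+ 2 = al * hn (B (val x.1.1)) ^+ 2 +
  hn (x.1.2 + eps%:C *: val x.1.1) ^+ 2 + K * hn x.2 ^+ 2.
Proof.
case: x => [[x1 x2] x3]; rewrite /energy rnorm_H1/= linopZ ?(valP x1)//.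
rewrite !(normZ hnP) !normc_real ?sqrtr_ge0// !exprMn.
by rewrite !sqr_sqrtr ?ltW.
Qed.

Lemma energyP : is_norm energy.
Proof.
have nP := @rnormP R (H1 B).
have s1 : (sqrtr al)%:C != 0 :> R[i] by rewrite eq_complex/= eqxx andbT sqrtr_eq0 -ltNge.
have s3 : (sqrtr K)%:C != 0 :> R[i] by rewrite eq_complex/= eqxx andbT sqrtr_eq0 -ltNge.
split=> [x y|k x|x].
- by rewrite /energy raddfD (normD nP).
- by rewrite /energy linearZ/= (normZ nP).
- move=> /(norm_eq0 nP); case: x => [[x1 x2] x3].
  move=> h.
  have h1 : (sqrtr al)%:C *: x1 = 0 := congr1 (fun z : H1 B => z.1.1) h.
  have h2 : x2 + eps%:C *: val x1 = 0 := congr1 (fun z : H1 B => z.1.2) h.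
  have h3 : (sqrtr K)%:C *: x3 = 0 := congr1 (fun z : H1 B => z.2) h.
  have x10 : x1 = 0 by move/eqP: h1; rewrite scaler_eq0 (negPf s1) => /eqP.
  have x30 : x3 = 0 by move/eqP: h3; rewrite scaler_eq0 (negPf s3) => /eqP.
  by move: h2; rewrite x10 x30 /= scaler0 addr0 => ->.
Qed.

Variable C : R.
Hypothesis C_ge1 : 1 <= C.
Hypothesis sqrt_bound : forall v, v \in dom B -> hn v <= C * hn (B v).

Lemma energy_components (x : H1 B) :
  [/\ sqrtr al * hn (B (val x.1.1)) <= energy x,
      hn (x.1.2 + eps%:C *: val x.1.1) <= energy x &
      sqrtr K * hn x.2 <= energy x].
Proof.
have E := energyE x; have n0 : 0 <= energy x := norm_ge0 energyP x.
have h z : 0 <= z -> z ^+ 2 <= energy x ^+ 2 -> z <= energy x.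
  by move=> z0; rewrite ler_pXn2r ?nnegrE.
have p0 := norm_ge0 hnP (B (val x.1.1)); have r0 := norm_ge0 hnP x.2.
have q0 := norm_ge0 hnP (x.1.2 + eps%:C *: val x.1.1).
have p2 : 0 <= al * hn (B (val x.1.1)) ^+ 2 by rewrite mulr_ge0 ?sqr_ge0// ltW.
have r2 : 0 <= K * hn x.2 ^+ 2 by rewrite mulr_ge0 ?sqr_ge0// ltW.
split; apply: h; rewrite ?mulr_ge0 ?sqrtr_ge0// E.
- by rewrite exprMn (sqr_sqrtr (ltW al_gt0)) -addrA lerDl addr_ge0// sqr_ge0.
- by rewrite addrAC lerDr addr_ge0.
- by rewrite exprMn (sqr_sqrtr (ltW K_gt0)) lerDr addr_ge0// sqr_ge0.
Qed.

Lemma hn_val_le (x : H1 B) : hn (val x.1.1) <= C * hn (B (val x.1.1)).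
Proof. by rewrite sqrt_bound// (valP x.1.1). Qed.

Lemma energy_le_l1norm : exists2 k : R, 0 < k & forall x, energy x <= k * l1norm x.
Proof.
have s1 : 0 < sqrtr al by rewrite sqrtr_gt0.
have s3 : 0 < sqrtr K by rewrite sqrtr_gt0.
have eC : 0 < eps * C by rewrite mulr_gt0 ?(lt_le_trans ltr01 C_ge1).
exists (sqrtr al + eps * C + 1 + sqrtr K) => [|x]; first by rewrite !addr_gt0.
rewrite (le_trans (rnorm_le_l1norm _))// /l1norm/= linopZ ?(valP x.1.1)//.
rewrite !(normZ hnP) !normc_real ?sqrtr_ge0//.
have h := normD hnP x.1.2 (eps%:C *: val x.1.1).
rewrite (normZ hnP) (normc_real (ltW eps_gt0)) in h.
have h' : eps * hn (val x.1.1) <= eps * C * hn (B (val x.1.1)).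
  by rewrite -mulrA ler_pM2l// hn_val_le.
have p0 := norm_ge0 hnP (B (val x.1.1)); have r0 := norm_ge0 hnP x.2.
have q0 := norm_ge0 hnP x.1.2; nra.
Qed.

Lemma l1norm_le_energy : exists2 k : R, 0 < k & forall x, l1norm x <= k * energy x.
Proof.
have s1 : 0 < sqrtr al by rewrite sqrtr_gt0.
have s3 : 0 < sqrtr K by rewrite sqrtr_gt0.
have eC : 0 < eps * C by rewrite mulr_gt0 ?(lt_le_trans ltr01 C_ge1).
exists ((sqrtr al)^-1 + (1 + eps * C / sqrtr al) + (sqrtr K)^-1) => [|x].
  by rewrite !addr_gt0// ?invr_gt0// divr_gt0.
have [h1 h2 h3] := energy_components x.
have n0 : 0 <= energy x := norm_ge0 energyP x.
have {}h1 : hn (B (val x.1.1)) <= (sqrtr al)^-1 * energy x by rewrite ler_pdivlMl.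
have {}h3 : hn x.2 <= (sqrtr K)^-1 * energy x by rewrite ler_pdivlMl.
have h4 : hn x.1.2 <= energy x + eps * hn (val x.1.1).
  rewrite -[x.1.2 in leLHS](addrK (eps%:C *: val x.1.1)).
  rewrite (le_trans (normB hnP _ _))// (normZ hnP) (normc_real (ltW eps_gt0)) lerD2r//.
have h5 : eps * hn (val x.1.1) <= eps * C * ((sqrtr al)^-1 * energy x).
  by rewrite -mulrA ler_pM2l// (le_trans (hn_val_le x))// ler_wpM2l ?(le_trans ler01 C_ge1).
rewrite /l1norm !mulrDl mul1r lerD// lerD// (le_trans h4)// lerD2l.
by rewrite (le_trans h5)// mulrA.
Qed.

Lemma energy_complete u : cauchys energy u -> exists l, cvgs energy u l.
Proof.
move=> uc.
have [k1 k10 h1] := l1norm_le_energy; have [k2 k20 h2] := energy_le_l1norm.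
have {}uc : cauchys l1norm u := cauchys_le k10 h1 uc.
have part (F : H1 B -> H) : (forall x y, F (x - y) = F x - F y) ->
    (forall x, hn (F x) <= l1norm x) -> exists l, cvgs hn (fun n => F (u n)) l.
  move=> FB Fl; apply: rnorm_complete => e e0; have [n0 h] := uc e e0.
  exists n0 => m n hm hn'; rewrite -FB (le_trans (Fl _))//; exact: h.
have n0 (v : H) : 0 <= hn v := norm_ge0 hnP v.
have BB (x y : dom_type B) : B (val (x - y)) = B (val x) - B (val y).
  by rewrite raddfB/= linopB ?(valP x) ?(valP y).
have [v1 l1] : exists l, cvgs hn (fun n => B (val (u n).1.1)) l.
  apply: (part (fun x => B (val x.1.1))) => [x y|x]; first exact: BB.
  by rewrite /l1norm -addrA lerDl addr_ge0.
have [v2 l2] : exists l, cvgs hn (fun n => (u n).1.2) l.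
  apply: (part (fun x => x.1.2)) => [x y|x] //.
  by rewrite /l1norm addrAC lerDr addr_ge0.
have [v3 l3] : exists l, cvgs hn (fun n => (u n).2) l.
  apply: (part (fun x => x.2)) => [x y|x] //.
  by rewrite /l1norm lerDr addr_ge0.
have C0 : 0 < C := lt_le_trans ltr01 C_ge1.
(* The bound of $x_1$ by $Bx_1$ makes the first component converge in [H] too; closedness of [B]
   then places its limit in the domain. *)
have [v0 l0] : exists l, cvgs hn (fun n => val (u n).1.1) l.
  apply: rnorm_complete => e e0.
  have [m0 h] := uc _ (divr_gt0 e0 C0); exists m0 => m n hm hn'.
  have := h m n hm hn'; rewrite ler_pdivlMr// mulrC; apply: le_trans.
  apply: (le_trans (hn_val_le (u m - u n))); rewrite ler_pM2l//.
  by rewrite /l1norm -addrA lerDl addr_ge0.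
have [v0B Bv0] := sqrt_closed ip_norm (fun n => valP (u n).1.1) l0 l1.
exists ((Sub v0 v0B, v2), v3) => e e0.
have e3 : 0 < e / k2 / 3 by rewrite !divr_gt0.
have [[n1 a1] [n2 a2]] := (l1 _ e3, l2 _ e3); have [n3 a3] := l3 _ e3.
exists (maxn n1 (maxn n2 n3)) => n; rewrite !geq_max => /and3P[m1 m2 m3].
rewrite (le_trans (h2 _))// -ler_pdivlMl// mulrC.
have -> : e / k2 = e / k2 / 3 + e / k2 / 3 + e / k2 / 3 by field; rewrite gt_eqF.
rewrite /l1norm/= lerD ?(a3 _ m3)// lerD ?(a2 _ m2)//.
have := a1 _ m1; rewrite -{1}Bv0 -(BB (u n).1.1 (Sub v0 v0B)); exact.
Qed.

Lemma rnorm_le_energy : exists2 k : R, 0 < k &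
  forall x : H1 B, `|x| <= (k * energy x)%:C.
Proof.
have [k k0 h] := l1norm_le_energy; exists k => // x.
by rewrite rnormE lecR (le_trans (rnorm_le_l1norm _)).
Qed.

Lemma energy_le_rnorm : exists2 k : R, 0 < k &
  forall x : H1 B, (energy x)%:C <= k%:C * `|x|.
Proof.
have [k k0 h] := energy_le_l1norm; exists (k * 3) => [|x]; first by rewrite mulr_gt0.
by rewrite rnormE -rmorphM lecR (le_trans (h x))// -mulrA ler_pM2l// l1norm_le_rnorm.
Qed.

End EnergyNorm.

(** * The block operator: sectoriality, dense domain and dense range *)

Section DampedWave.
Variables (R : realType) (H : completeNormedModType R[i]) (ip : {dot H for conjC}).
Hypothesis ip_norm : forall x, `|x| ^+ 2 = ip x x.
Variables (A : pos_self_adjoint ip) (B : pos_sqrt A).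
Variables (mu C a b c eps : R).
Hypothesis mu_min : forall l, spectrum A l -> mu%:C <= l.
Hypothesis mu_gt0 : 0 < mu.
Hypothesis C_ge1 : 1 <= C.
Local Notation hn := (@rnorm R H).
Hypothesis sqrt_bound : forall v, v \in dom B -> hn v <= C * hn (B v).
Hypotheses (a_gt0 : 0 < a) (b_gt0 : 0 < b) (c_gt0 : 0 < c) (eps_gt0 : 0 < eps).
Hypothesis eps_c : eps * b <= c ^+ 2 / 2.
Hypothesis eps_b : eps * C ^+ 2 <= b / 4.

Let hnP := @rnormP R H.
(* With this weight [al] the terms pairing $x_1$ and $w$ in [energy_form]
   combine to an imaginary number; the weight [K] lets the diffusion of $x_3$
   absorb $\langle x_3, w \rangle$. *)
Let al := c ^+ 2 - b * eps.
Let K := 2 * C ^+ 4 / (a * b).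
Local Notation G := (opA B a%:C b%:C c%:C).
Local Notation Nrg := (@energy R H ip A B al K eps).

Let al_gt0 : 0 < al.
Proof. by move: (exprn_gt0 2 c_gt0) eps_c; rewrite /al; lra. Qed.

Let K_gt0 : 0 < K.
Proof.
have C0 := lt_le_trans ltr01 C_ge1.
by rewrite /K divr_gt0 ?mulr_gt0// exprn_gt0.
Qed.

Lemma insub_val z : z \in dom A -> val (insubd (0 : dom_type B) z) = z.
Proof. by move=> zA; rewrite val_insubd (sqrt_dom_sub B zA). Qed.

Lemma ip_opE x y : x \in dom A -> y \in dom B -> ip (A x) y = ip (B x) (B y).
Proof.
move=> xA yB; have := xA; rewrite (sqrt_domE B) => /andP[xB BxB].
by rewrite -(sqrt_sqr B xA) sqrt_sym.
Qed.

(** Substituting $x_2 = w - \varepsilon x_1$ turns $-c^2\mathcal Ax_1 - b\mathcal Ax_2$ into $-(c^2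
    - b\varepsilon)\mathcal Ax_1 - b\mathcal Aw$, which is the origin of [al]. Every $\mathcal A$ is
    then split symmetrically by [ip_opE]. *)
Lemma energy_form (x1 : dom_type B) x2 x3 :
  val x1 \in dom A -> x2 \in dom A -> x3 \in dom A ->
  let w := x2 + eps%:C *: val x1 in
  let x : H1 B := (x1, x2, x3) in
  ip1 B (energy_map al K eps (G x)) (energy_map al K eps x) =
  al%:C * ip (B w) (B (val x1)) - (al * eps)%:C * ip (B (val x1)) (B (val x1))
  - al%:C * ip (B (val x1)) (B w) - b%:C * ip (B w) (B w) + ip x3 w
  + eps%:C * ip w w - (eps ^+ 2)%:C * ip (val x1) w
  - (K * a)%:C * ip (B x3) (B x3).
Proof.
move=> x1A x2A x3A w x.
have wA : w \in dom A by rewrite rpredD ?rpredZ.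
have wB := sqrt_dom_sub B wA; have x1B := valP x1.
have x2B := sqrt_dom_sub B x2A; have x3B := sqrt_dom_sub B x3A.
have x2E : x2 = w - eps%:C *: val x1 by rewrite addrK.
rewrite /ip1/= /ipH1/= insub_val// !linopZ ?insub_val//.
have s2 (t : R) : 0 < t -> (sqrtr t)%:C * ((sqrtr t)%:C)^* = t%:C :> R[i].
  move=> t0; rewrite conj_Creal ?complex_real//.
  by rewrite -rmorphM -expr2 sqr_sqrtr ?ltW.
have Bx2 : B x2 = B w - eps%:C *: B (val x1) by rewrite x2E linopB ?rpredZ// linopZ.
have wE : x2 + eps%:C *: val x1 = w by [].
have alE : al%:C = c%:C ^+ 2 - b%:C * eps%:C :> R[i].
  by rewrite /al rmorphB rmorphXn rmorphM.
clearbody w; have x2w : ip x2 w = ip w w - eps%:C * ip (val x1) w.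
  by rewrite {1}x2E dotBl dotZl.
rewrite !dotZl !dotZr !mulrA !s2// wE !(dotDl, dotNl, dotZl) !ip_opE// x2w.
rewrite Bx2 !dotBl !dotZl /= rmorphXn !rmorphM/= alE.
move: (ip _ _) (ip _ _) (ip _ _) (ip _ _) (ip _ _) (ip _ _) (ip _ _) (ip _ _).
move: al%:C b%:C c%:C eps%:C K%:C a%:C => *.
ring.
Qed.

Lemma energy_dissipative : exists2 k : R, 0 < k &
  forall w x, cone k w -> x \in dom G -> Nrg x <= Nrg (x - w *: G x).
Proof.
have [k k0 h] := sectorial_arith b_gt0 c_gt0 C_ge1 eps_gt0 eps_c eps_b.
exists k => // z [[x1 x2] x3] kz /and3P[/= x1A x2A x3A].
set x : H1 B := (x1, x2, x3).
pose w := x2 + eps%:C *: val x1.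
have wA : w \in dom A by rewrite rpredD ?rpredZ.
have wB := sqrt_dom_sub B wA; have x1B := valP x1.
have x3B := sqrt_dom_sub B x3A.
have nP := @rnormP R (H1 B).
have E y : Nrg y ^+ 2 = dnorm2 (ip1 B) (energy_map al K eps y).
  apply: complexI; rewrite -dnorm2E rmorphXn /= -rnormE.
  exact: (dot_normE (ip1 B)).
rewrite -(@ler_pXn2r _ 2)// ?nnegrE ?(norm_ge0 nP)// !E.
have -> : energy_map al K eps (x - z *: G x) =
    energy_map al K eps x - z *: energy_map al K eps (G x).
  by rewrite raddfB; congr (_ - _); exact: linearZ.
apply: dissipative_le; rewrite energy_form// -/w.
set p := hn (B (val x1)); set q := hn (B w); set r := hn (B x3); set m := hn w.
have p0 : 0 <= p := norm_ge0 hnP _; have q0 : 0 <= q := norm_ge0 hnP _.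
have r0 : 0 <= r := norm_ge0 hnP _; have m0 : 0 <= m := norm_ge0 hnP _.
have mq : m <= C * q := sqrt_bound wB.
have C0 : 0 <= C := le_trans ler01 C_ge1.
have x3w : hn x3 * hn w <= C ^+ 2 * r * q.
  have -> : C ^+ 2 * r * q = (C * r) * (C * q) by ring.
  by rewrite ler_pM ?(norm_ge0 hnP)// sqrt_bound.
have x1w : hn (val x1) * hn w <= C ^+ 2 * p * q.
  have -> : C ^+ 2 * p * q = (C * p) * (C * q) by ring.
  by rewrite ler_pM ?(norm_ge0 hnP)// sqrt_bound.
(* With [x], [y] taken as the real and imaginary parts of [z], the inequality of [sectorial_arith]
   says that [z] times the form has nonpositive real part. *)
have := h p q r m (complex.Im (ip (B (val x1)) (B w)))
  (complex.Re (ip x3 w)) (complex.Im (ip x3 w))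
  (complex.Re (ip (val x1) w)) (complex.Im (ip (val x1) w))
  (complex.Re z) (complex.Im z) p0 q0 r0 m0 mq
  (ip_Im_le ip_norm _ _) (le_trans (ip_Re_le ip_norm _ _) x3w)
  (le_trans (ip_Im_le ip_norm _ _) x3w) (le_trans (ip_Re_le ip_norm _ _) x1w)
  (le_trans (ip_Im_le ip_norm _ _) x1w) kz.
rewrite (dot_sym ip (B w) (B (val x1))) !(ip_rnorm ip_norm) -/p -/q -/r -/m.
have -> : 2 * C ^+ 4 / b = K * a by rewrite /K; field; rewrite !gt_eqF.
rewrite -/al.
move: (ip _ _) (ip _ _) (ip _ _) => [X1 X2] [Y1 Y2] [Z1 Z2]; case: (z) => u v /=.
simpc => /=.
apply: le_trans; rewrite le_eqVlt; apply/orP; left; apply/eqP.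
ring.
Qed.

(** Only the first coordinate is changed, because [opA_range] asks for nothing else: it solves
    exactly whenever $f_1 \in \mathcal D(\mathcal A)$. *)
Lemma sqrt_coord_dense (x : H1 B) e : 0 < e -> exists x1 : dom_type B,
  val x1 \in dom A /\ Nrg (x - ((x1, x.1.2), x.2)) <= e.
Proof.
move=> e0; have [k k0 h] :=
  energy_le_l1norm ip_norm al_gt0 K_gt0 eps_gt0 C_ge1 sqrt_bound.
have [x1 x1A x1e] := dom_sqrt_dense mu_min mu_gt0 (valP x.1.1) (divr_gt0 e0 k0).
exists (Sub x1 (sqrt_dom_sub B x1A)); split; first by rewrite SubK.
rewrite (le_trans (h _))// -ler_pdivlMl// mulrC /l1norm/= !subrr (norm0 hnP) !addr0.
by rewrite linopB ?(sqrt_dom_sub B x1A) ?(valP x.1.1)// (norm_sym hnP).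
Qed.

Lemma energy_dense (x : H1 B) e : 0 < e ->
  exists2 x', x' \in dom G & Nrg (x - x') <= e.
Proof.
move=> e0; have [k k0 h] :=
  energy_le_l1norm ip_norm al_gt0 K_gt0 eps_gt0 C_ge1 sqrt_bound.
have e2 : 0 < e / 2 by rewrite divr_gt0.
have e4 : 0 < e / 2 / 2 / k by rewrite !divr_gt0.
have [dA _] := psa_self_adjoint A.
have [x1 [x1A x1e]] := sqrt_coord_dense x e2.
have [x2 x2A x2e] := dense_rnorm x.1.2 dA e4.
have [x3 x3A x3e] := dense_rnorm x.2 dA e4.
exists ((x1, x2), x3); first by apply/and3P.
have nP : is_norm Nrg by exact: energyP.
rewrite (le_trans (norm_trans nP ((x1, x.1.2), x.2) _ _))// [leRHS]splitr lerD//.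
rewrite (le_trans (h _))// -ler_pdivlMl// [leRHS]mulrC [leRHS]splitr.
rewrite /l1norm/= subrr linop0 (norm0 hnP) add0r lerD//.
  by rewrite mulrAC.
by rewrite mulrAC.
Qed.

Lemma cone_Re_gt0 k (w : R[i]) : cone k w -> w != 0 -> 0 < k -> 0 < complex.Re w.
Proof.
move=> kw w0 k0; rewrite lt_neqAle (cone_Re_ge0 k0 kw) andbT eq_sym.
apply: contra w0; move: kw; rewrite /cone => + /eqP u0.
rewrite u0 mulr0 normr_le0 => /eqP v0.
by rewrite [w]complexE u0 v0 mulr0 addr0.
Qed.

(** The system is triangular: $x_3$ is found first, $x_1 = f_1 + wx_2$ is eliminated, and $x_2$
    solves a scalar equation in $\mathcal A$ with coefficient $wb + w^2c^2$. Its right-hand side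
    contains $\mathcal Af_1$, whence the assumption on $f_1$. *)
Lemma opA_range (w : R[i]) (f1 : dom_type B) f2 f3 :
  0 < complex.Re w -> val f1 \in dom A ->
  exists2 x, x \in dom G & x - w *: G x = ((f1, f2), f3) :> H1 B.
Proof.
move=> w0 f1A.
have surj s f : (0 < complex.Re s \/ complex.Im s != 0) ->
    exists2 x, x \in dom A & x + s *: A x = f.
  move=> s_; apply: (shift_surj mu_min mu_gt0) => [|t t0].
    by apply/eqP => s0; move: s_; rewrite s0/= ltxx eqxx => -[].
  apply/eqP => st; move: s_; rewrite st/= oppr0 eqxx oppr_gt0 => -[]// /lt_trans.
  by move=> /(_ _ t0); rewrite ltxx.
have [|x3 x3A x3E] := surj (w * a%:C) f3.
  by left; case: (w) w0 => u v /= u0; rewrite mulr0 subr0 mulr_gt0.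
have [|x2 x2A x2E] := surj (w * b%:C + w ^+ 2 * c%:C ^+ 2)
    (f2 + w *: x3 - (w * c%:C ^+ 2) *: A (val f1)).
  (* The imaginary part is $v(b + 2uc^2)$ with $u > 0$; it vanishes only for $v = 0$, when the
     coefficient is positive. *)
  case: (w) w0 => u v /= u0; simpc => /=.
  have [->|v0] := eqVneq v 0; [left|right].
    by rewrite mul0r subr0 addr_gt0 ?mulr_gt0.
  have -> : v * b + (u * v + v * u) * (c * c) = v * (b + 2 * u * (c * c)) by ring.
  by rewrite mulf_neq0// gt_eqF// addr_gt0// !mulr_gt0.
have x1A : val f1 + w *: x2 \in dom A by rewrite rpredD ?rpredZ.
pose x1 : dom_type B := Sub (val f1 + w *: x2) (sqrt_dom_sub B x1A).
exists ((x1, x2), x3); first by apply/and3P; split; rewrite ?SubK.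
rewrite /opA/=; congr (_, _, _).
- by apply/val_inj; rewrite raddfB linearZ/= insub_val// scalerN addrK.
- have -> : f2 = x2 + (w * b%:C + w ^+ 2 * c%:C ^+ 2) *: A x2 +
      (w * c%:C ^+ 2) *: A (val f1) - w *: x3 by rewrite x2E subrK addrK.
  transitivity (x2 - w *: (- (c%:C ^+ 2 *: A (val f1 + w *: x2)) -
    b%:C *: A x2 + x3)); first by [].
  rewrite linopD ?rpredZ// linopZ// !scalerDr !scalerN !opprD !opprK !scalerDr !scalerA.
  have -> : w * c%:C ^+ 2 * w = w ^+ 2 * c%:C ^+ 2 by ring.
  by rewrite scalerDl !addrA [in LHS](ACl (1*4*3*2*5)).
- transitivity (x3 - w *: - (a%:C *: A x3)); first by [].
  by rewrite -x3E scalerN opprK scalerA.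
Qed.

Lemma energy_sectorial : exists k,
  sectorial Nrg k (fun x y => graph G (x, y)).
Proof.
have [k k0 diss] := energy_dissipative; exists k.
have nP : is_norm Nrg by exact: energyP.
split=> //.
- exact: (energy_complete ip_norm al_gt0 K_gt0 eps_gt0 C_ge1 sqrt_bound).
- move=> z x y x' y' [/= xG <-] [/= x'G <-]; split => /=.
    by rewrite rpredD ?rpredZ.
  exact: (linopP (l := G) z xG x'G).
- move=> x e /(energy_dense x)[x' x'G h]; exists x', (G x'); by split.
- by move=> w x y kw [/= xG <-]; exact: diss.
- move=> w f e kw w0 e0; have [f1 [f1A h]] := sqrt_coord_dense f e0.
  have [x xG xE] := opA_range f.1.2 f.2 (cone_Re_gt0 kw w0 k0) f1A.
  by exists x, (G x); rewrite xE.
Qed.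

Lemma damped_wave_generates : generates_analytic_semigroup G.
Proof.
have nP : is_norm Nrg by exact: energyP.
have [k GP] := energy_sectorial.
have [c1 c10 h1] := rnorm_le_energy ip_norm al_gt0 K_gt0 eps_gt0 C_ge1 sqrt_bound.
have [c2 c20 h2] := energy_le_rnorm ip_norm al_gt0 K_gt0 eps_gt0 C_ge1 sqrt_bound.
exact: (sectorial_generates_analytic_semigroup c10 c20 h1 h2 nP GP).
Qed.

End DampedWave.

Theorem theorem3p6 (R : realType) (H : completeNormedModType R[i])
    (ip : {dot H for conjC})
    (ip_norm : forall x, `|x| ^+ 2 = ip x x)
    (H_separable : exists2 S : set H, countable S & dense S)
    (A : pos_self_adjoint ip) (Ahalf : pos_sqrt A)
    (mu : R) (mu_spectrum : spectrum A mu%:C)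
    (mu_min : forall l, spectrum A l -> mu%:C <= l) (mu_gt0 : 0 < mu)
    (C1 C2 C3 : R)
    (bound1 : forall v, v \in dom Ahalf -> `|v| <= C1%:C * `|Ahalf v|)
    (bound2 : forall v, v \in dom A -> `|v| <= C2%:C * `|A v|)
    (bound3 : forall v, v \in dom A -> A v \in dom Ahalf ->
      `|v| <= C3%:C * `|Ahalf (A v)|)
    (a b c : R) (a_gt0 : 0 < a) (b_gt0 : 0 < b) (c_gt0 : 0 < c) :
  generates_analytic_semigroup (opA Ahalf a%:C b%:C c%:C).
Proof.
pose C := Num.max 1 C1; have C_ge1 : 1 <= C by rewrite le_max lexx.
have C2_gt0 : 0 < C ^+ 2 by rewrite exprn_gt0// (lt_le_trans ltr01).
pose eps := Num.min (c ^+ 2 / 2 / b) (b / 4 / C ^+ 2).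
have eps_gt0 : 0 < eps by rewrite lt_min !divr_gt0// exprn_gt0.
have eps_c : eps * b <= c ^+ 2 / 2 by rewrite -ler_pdivlMr// ge_min lexx.
have eps_b : eps * C ^+ 2 <= b / 4 by rewrite -ler_pdivlMr// ge_min lexx orbT.
exact: (damped_wave_generates ip_norm mu_min mu_gt0 C_ge1 (sqrt_bound bound1)
  a_gt0 b_gt0 c_gt0 eps_gt0 eps_c eps_b).
Qed.
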